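(* For every integer $m\ge 3$ and every integer $d\ge 2$, the digraph $D_d(m)$ has a decomposition into $d$ directed Hamilton cycles; that is, the arc set of $D_d(m)$ can be partitioned into $d$ directed cycles each of which visits every vertex exactly once.
   Context: For integers $m\ge2$, $d\ge2$, write $\mathbb Z_m=\mathbb Z/m\mathbb Z$. $D_d(m)$ is the Cayley digraph $\mathrm{Cay}(\mathbb Z_m^d,\{e_1,\dots,e_d\})$, where $e_1,\dots,e_d$ are the standard coordinate vectors: its vertex set is $\mathbb Z_m^d$ and its arcs are $x\to x+e_i$ for $x\in\mathbb Z_m^d$, $1\le i\le d$. Equivalently it is the Cartesian product of $d$ directed cycles of length $m$. *)

(* Defs.v *)
From mathcomp Require Import all_boot all_algebra.

Set Implicit Arguments.
Unset Strict Implicit.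
Unset Printing Implicit Defensive.

Import GRing.Theory.
Local Open Scope ring_scope.

(* A digraph on a finType is given by its arc set, a set of ordered pairs
   (tail, head). *)

Definition cayley_arcs (G : finZmodType) (S : {set G}) : {set G * G} :=
  [set (x, x + s) | x in [set: G], s in S].

Definition coord_vectors (m d : nat) : {set 'rV['Z_m]_d} :=
  [set delta_mx 0 i | i : 'I_d].

(* 'Z_m is the ring of integers modulo m only when 1 < m. *)
Definition torus_arcs (m d : nat) : {set 'rV['Z_m]_d * 'rV['Z_m]_d} :=
  cayley_arcs (coord_vectors m d).

Definition cycle_arcs (T : finType) (s : seq T) : {set T * T} :=
  [set (x, next s x) | x in s].

Definition is_hamilton_dicycle (T : finType) (A C : {set T * T}) : Prop :=
  exists s : seq T,
    [/\ ucycle (fun x y => (x, y) \in A) s,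
        forall x : T, x \in s
      & C = cycle_arcs s].

Definition hamilton_decomposition (T : finType) (A : {set T * T}) (k : nat)
    (P : {set {set T * T}}) : Prop :=
  [/\ partition P A,
      #|P| = k
    & forall C : {set T * T}, C \in P -> is_hamilton_dicycle A C].

(* Main.v *)
Require Import Defs.
From mathcomp Require Import all_boot all_algebra perm zify ring.

Set Implicit Arguments.
Unset Strict Implicit.
Unset Printing Implicit Defensive.

(** The decomposition is built as a colouring of the arcs: at every vertex each
    of the [d] colours is given one of the [d] directions, and a colour is a
    Hamilton cycle when the map that follows it has a single orbit
    ([ham_decomposable], [hamilton_decomposition_torus]). Write [D_k] for the
    torus of dimension [k]. The proof is by strong induction on the dimension;
    [D_1] is a cycle.

    Dimension [2 k]. [D_(2 k)] is the product of two copies of [D_k]. Each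
    Hamilton cycle of [D_k] gives the square of a directed cycle, whose arcs
    split into two Hamilton cycles when the two directions are exchanged along
    the antidiagonal ([ham_decomposable_square]).

    Dimension [2 k + 1]. [D_(2 k + 1)] is the product of a directed [m]-cycle
    with two copies of [V = D_k], [N = m ^ k] vertices each. The sum of all
    coordinates modulo [m] increases by one along every arc, so the vertices
    are the pairs of a layer and an element of [V * V], and in these
    coordinates the arcs of the directed cycle fix the point of [V * V]. A
    colour is a Hamilton cycle as soon as the composite of its [m] layer maps
    is a single cycle on [V * V] ([layered_single_orbit]). Let [f i] be the
    Hamilton cycles of [V]. For each [i] but one, two colours follow [f i] in
    the two copies and exchange the copies in one layer; they are skew products
    ([single_orbit_skew]). This works only if they are disturbed in a number of
    rows that is prime to [m], and those special rows are paid for by the first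
    of the three remaining colours, which may use any cycle [f i] in any row
    ([odd_decomposable]). It remains to share three directions, namely to stay
    put, to advance in the first copy and to advance in the second one, between
    the last three colours.

    If [m] is odd, three skew-like maps do it ([odd_length_decomposable], and
    [three_odd_decomposable] when [k = 1]). If [m] is even, one layer is
    a pattern that departs from three translations along a few rows, a column
    and an antidiagonal only. The tracks of each colour can then be followed
    from end to end ([three_even_decomposable] when [k = 1]). When [k > 1],
    the two colours that no special row concerns are followed through their
    return maps to one row or one column. Such a return map is a translation of the cycle of length
    [N] by an even number, which has two orbits, the parity classes, followed
    by a rewiring of four or five points that joins the two orbits into one
    ([rewired_pair], [even_length_decomposable]). The cube over cycles of
    length 4 is too small for the pattern and is settled by an explicit table
    ([three_four_decomposable]). *)

(** * Maps with a single orbit *)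

(** The permutations of [T] that are one cycle through all of [T]; injectivity
    is a consequence, see [single_orbit_inj]. *)
Definition single_orbit (T : finType) (F : T -> T) : Prop :=
  forall x y, fconnect F x y.

Lemma single_orbit_inj (T : finType) (F : T -> T) :
  single_orbit F -> injective F.
Proof.
move=> orbF; pose G y := iter (findex F (F y) y) F y.
have GK : cancel G F.
  by move=> y; rewrite /G -iterS iterSr iter_findex //; apply: orbF.
exact: (bij_inj (Bijective (canF_sym GK) GK)).
Qed.

Lemma single_orbitI (T : finType) (F : T -> T) (x0 : T) :
  injective F -> (forall x, fconnect F x x0) -> single_orbit F.
Proof.
move=> injF to0 x y.
by rewrite (connect_trans (to0 x)) // fconnect_sym.
Qed.

Lemma eq_single_orbit (T : finType) (F G : T -> T) :
  F =1 G -> single_orbit F -> single_orbit G.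
Proof. by move=> eqFG orbF x y; rewrite -(eq_fconnect eqFG). Qed.

Lemma single_orbit_iter (T : finType) (F : T -> T) :
  (forall x y, exists n, iter n F x = y) -> single_orbit F.
Proof. by move=> H x y; have [n <-] := H x y; apply: fconnect_iter. Qed.

(** The two composites are conjugate, so the point of the cycle at which one
    starts reading may be moved past any of the factors. *)
Lemma single_orbit_conj (T : finType) (A B : T -> T) :
  injective A -> single_orbit (B \o A) -> single_orbit (A \o B).
Proof.
move=> injA orb; apply: single_orbit_iter => x y.
have [A' A'K AK'] := injF_bij injA.
have := iter_findex (orb (B x) (A' y)); set n := findex _ _ _ => Hn.
exists n.+1; rewrite iterSr -[y]AK' -Hn /=.
by elim: (n) => //= j ->.
Qed.

Lemma single_orbit_transport (T T' : finType) (phi : T -> T') (psi : T' -> T)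
    (F : T -> T) (F' : T' -> T') :
  cancel psi phi -> (forall x, phi (F x) = F' (phi x)) ->
  single_orbit F -> single_orbit F'.
Proof.
move=> psiK phiF orbF; apply: single_orbit_iter => x y.
have phi_iter n z : phi (iter n F z) = iter n F' (phi z).
  by elim: n => //= n IHn; rewrite phiF IHn.
exists (findex F (psi x) (psi y)).
by rewrite -[x in iter _ _ x]psiK -phi_iter iter_findex ?psiK.
Qed.

Section Coordinates.

Variables (T : finType) (F : T -> T) (x0 : T).
Hypothesis orbF : single_orbit F.

(** The labelling of the unique cycle of [F] by integers, starting at [x0]. *)
Definition orbit_pt (i : nat) : T := iter i F x0.
Definition orbit_pos (x : T) : nat := findex F x0 x.

Lemma order_single_orbit x : order F x = #|T|.
Proof.
by rewrite /order; apply: eq_card => y; rewrite !inE; apply: orbF.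
Qed.

Lemma pos_lt x : orbit_pos x < #|T|.
Proof. by rewrite -(order_single_orbit x0) findex_max. Qed.

Lemma posK x : orbit_pt (orbit_pos x) = x.
Proof. exact: iter_findex. Qed.

Lemma ptK i : i < #|T| -> orbit_pos (orbit_pt i) = i.
Proof. by move=> lti; rewrite /orbit_pos findex_iter // order_single_orbit. Qed.

Lemma pt_period i : orbit_pt (i + #|T|) = orbit_pt i.
Proof.
rewrite /orbit_pt iterD -(order_single_orbit x0).
by rewrite (iter_order (single_orbit_inj orbF)).
Qed.

Lemma iter_period n x : iter (n * #|T|) F x = x.
Proof.
elim: n => // n IHn; rewrite mulSn iterD IHn -(order_single_orbit x).
by rewrite (iter_order (single_orbit_inj orbF)).
Qed.

Lemma eq_pt i j : i < #|T| -> j < #|T| -> (orbit_pt i == orbit_pt j) = (i == j).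
Proof.
move=> lti ltj; apply/eqP/eqP => [E|-> //].
by rewrite -(ptK lti) E ptK.
Qed.

Lemma eq_pos x j : j < #|T| -> (orbit_pos x == j) = (x == orbit_pt j).
Proof. by move=> ltj; apply/eqP/eqP => [<-|->]; rewrite ?posK ?ptK. Qed.

End Coordinates.

(** Bezout: a power with exponent prime to the length of the cycle has the
    original map among its own powers. *)
Lemma single_orbit_expn (T : finType) (F : T -> T) (b : nat) :
  single_orbit F -> coprime b #|T| -> single_orbit (iter b F).
Proof.
move=> orbF cop; apply: single_orbit_iter => x y.
have gt0 : 0 < #|T| by apply/card_gt0P; exists x.
have [[|b'] b_eq] : exists n, b = n by exists b.
  rewrite b_eq /coprime gcd0n in cop; have := eqP cop => T1.
  exists 0; apply/eqP; have/card_le1_eqP : #|T| <= 1 by rewrite T1.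
  by move=> H; apply/eqP/H.
case: (egcdnP #|T| (_ : 0 < b)) => [|u v Huv _]; first by rewrite b_eq.
rewrite (eqP cop) in Huv.
exists (findex F x y * u); rewrite -iterM -mulnA Huv mulnDr muln1 mulnA addnC iterD.
by rewrite iter_period // iter_findex.
Qed.

(** The second coordinate runs through its cycle on its own; after one lap the
    first one has been advanced by [\sum_w phi w] steps, whatever its value. *)
Lemma single_orbit_skew (V W : finType) (f : V -> V) (g : W -> W)
    (phi : W -> nat) :
  single_orbit f -> single_orbit g -> coprime (\sum_w phi w) #|V| ->
  single_orbit (fun x : V * W => (iter (phi x.2) f x.1, g x.2)).
Proof.
move=> orbf orbg cop; set F := fun _ => _.
have iterF n v w :
    iter n F (v, w) = (iter (\sum_(i < n) phi (iter i g w)) f v, iter n g w).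
  elim: n => [|n IHn]; first by rewrite big_ord0.
  by rewrite iterS IHn /F /= big_ord_recr /= addnC iterD.
have lap w : \sum_(i < #|W|) phi (iter i g w) = \sum_w phi w.
  rewrite (reindex (fun i : 'I_#|W| => iter i g w)) //.
  exists (fun w' => Ordinal (pos_lt w orbg w')) => [i _|w' _].
    by apply: val_inj; rewrite /= [orbit_pos _ _ _]ptK.
  exact: posK.
have orbfs := single_orbit_expn orbf cop.
have lapF n v w : iter (n * #|W|) F (v, w) = (iter n (iter (\sum_w phi w) f) v, w).
  elim: n => //= n IHn; rewrite mulSn iterD IHn iterF lap.
  by rewrite -[#|W|]mul1n iter_period.
apply: single_orbit_iter => -[v w] [v' w'].
have [n Hn] : exists n, iter n g w = w' by exists (findex g w w'); rewrite iter_findex.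
have [k Hk] : exists k, iter k (iter (\sum_w phi w) f) (iter (\sum_(i < n) phi (iter i g w)) f v) = v'.
  by eexists; apply: iter_findex (orbfs _ _).
by exists (k * #|W| + n); rewrite iterD iterF Hn lapF Hk.
Qed.

Lemma pos0 (T : finType) (F : T -> T) (x0 : T) : orbit_pos F x0 x0 = 0.
Proof. exact: findex0. Qed.

Lemma pos_next (T : finType) (F : T -> T) (x0 x : T) :
  single_orbit F -> orbit_pos F x0 (F x) = (orbit_pos F x0 x).+1 %% #|T|.
Proof.
move=> orbF; rewrite -{1}[x](posK x0 orbF) -[F _]/(orbit_pt F x0 (orbit_pos F x0 x).+1).
have := pos_lt x0 orbF x; rewrite leq_eqVlt => /predU1P[->|ltN].
  by rewrite modnn -[#|T|]add0n pt_period // ptK //; apply/card_gt0P; exists x.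
by rewrite ptK // modn_small.
Qed.

(** For following a track of which only the steps outside [P] are known: the
    walk stops at the first point of [P], and no step beyond is needed. *)
Lemma run_until (T : Type) (g : T -> T) (P : pred T) (R : T -> T -> Prop) v :
  (forall u, R u u) -> (forall x y z, R x y -> R y z -> R x z) ->
  (exists n, P (iter n g v)) -> (forall u, ~~ P u -> R u (g u)) ->
  exists2 u, P u & R v u.
Proof.
move=> Rrefl Rtrans [n]; elim: n v => [|n IHn] v Pn step; first by exists v.
have [Pv|nPv] := boolP (P v); first by exists v.
rewrite iterSr in Pn; have [u Pu Ru] := IHn _ Pn step.
by exists u => //; apply: Rtrans (step _ nPv) Ru.
Qed.

(** * Hamilton decompositions as colourings *)

(** Here [step d x] is the head of the arc of direction [d] at [x], and
    [rule x c] is the direction of the arc of colour [c] at [x]. Injectivity of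
    [rule x] on the finite type of directions says that every arc at [x] has
    exactly one colour, so that the colours partition the arcs; each colour is
    a map of [X] to itself, and it is a Hamilton cycle when that map has a
    single orbit. *)
Definition ham_coloring (X D : finType) (step : D -> X -> X)
    (rule : X -> D -> D) : Prop :=
  (forall x, injective (rule x)) /\
  (forall c, single_orbit (fun x => step (rule x c) x)).

Definition ham_decomposable (X D : finType) (step : D -> X -> X) : Prop :=
  exists rule, ham_coloring step rule.

Lemma ham_decomposable_transport (X X' D D' : finType) (step : D -> X -> X)
    (step' : D' -> X' -> X') (phi : X -> X') (psi : X' -> X)
    (iota : D -> D') (kappa : D' -> D) :
  cancel psi phi -> cancel phi psi -> cancel iota kappa -> cancel kappa iota ->
  (forall d x, phi (step d x) = step' (iota d) (phi x)) ->
  ham_decomposable step -> ham_decomposable step'.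
Proof.
move=> psiK phiK iotaK kappaK stepE [rule [rule_inj rule_orb]].
exists (fun x' c' => iota (rule (psi x') (kappa c'))); split=> [x'|c'].
  by apply: inj_comp (can_inj iotaK) _; apply: inj_comp (rule_inj _) (can_inj kappaK).
apply: single_orbit_transport psiK _ (rule_orb (kappa c')) => x /=.
by rewrite phiK stepE.
Qed.

(** Once a Hamilton decomposition is fixed, its cycles may be used as new
    directions: a colouring of the digraph whose arcs are labelled by those
    cycles is a colouring of the original arcs. *)
Lemma ham_decomposable_refine (X D : finType) (step step' : D -> X -> X)
    (tau : X -> D -> D) :
  (forall x, injective (tau x)) -> (forall d x, step' d x = step (tau x d) x) ->
  ham_decomposable step' -> ham_decomposable step.
Proof.
move=> tau_inj stepE [rule [rule_inj rule_orb]].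
exists (fun x c => tau x (rule x c)); split=> [x|c].
  exact: inj_comp (tau_inj x) (rule_inj x).
by apply: eq_single_orbit (rule_orb c) => x; rewrite stepE.
Qed.

(** * The torus *)

Section Torus.

Import GRing.Theory.
Local Open Scope ring_scope.

Definition torus_step (m d : nat) (i : 'I_d) (x : 'rV['Z_m]_d) : 'rV['Z_m]_d :=
  x + delta_mx 0 i.

Lemma torus_step_inj (m d : nat) (x : 'rV['Z_m]_d) :
  injective (fun i => torus_step i x).
Proof.
move=> i j /addrI /matrixP /(_ 0 i); rewrite !mxE !eqxx /=.
by case: (i =P j) => // _ /eqP; rewrite oner_eq0.
Qed.

Lemma torus_arcsP (m d : nat) (x y : 'rV['Z_m]_d) :
  reflect (exists i, y = torus_step i x) ((x, y) \in torus_arcs m d).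
Proof.
apply: (iffP imset2P) => [[z s _ /imsetP[i _ ->] [-> ->]]|[i ->]].
  by exists i.
by exists x (delta_mx 0 i) => //; apply/imsetP; exists i.
Qed.

(** The set of arcs of a colour determines the colour because torus steps in
    distinct directions have distinct heads, which is where [1 != 0] in ['Z_m]
    enters; the sequence of vertices of the cycle is the orbit of [0]. *)
Lemma hamilton_decomposition_torus (m d : nat) :
  ham_decomposable (@torus_step m d) ->
  exists P : {set {set 'rV['Z_m]_d * 'rV['Z_m]_d}},
    hamilton_decomposition (torus_arcs m d) d P.
Proof.
case=> rule [rule_inj rule_orb].
pose f c x := torus_step (rule x c) x.
pose C c : {set 'rV['Z_m]_d * 'rV['Z_m]_d} := [set (x, f c x) | x in setT].
have memC c x y : ((x, y) \in C c) = (y == f c x).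
  apply/imsetP/eqP => [[z _ [-> ->]]|->] //.
  by exists x.
have C_disj c c' x y : (x, y) \in C c -> (x, y) \in C c' -> c = c'.
  by rewrite !memC => /eqP -> /eqP /torus_step_inj /rule_inj.
have C_inj : injective C.
  move=> c c' eqC; have in_c : (0, f c 0) \in C c by rewrite memC.
  by apply: C_disj (in_c) _; rewrite -eqC.
exists [set C c | c in 'I_d]; split.
- apply/and3P; split.
  + apply/eqP/setP => -[x y]; apply/bigcupP/torus_arcsP.
      case=> _ /imsetP[c _ ->]; rewrite memC => /eqP ->.
      by exists (rule x c).
    case=> i ->; have [rule' _ ruleK] := injF_bij (rule_inj x).
    exists (C (rule' i)); first by apply/imsetP; exists (rule' i).
    by rewrite memC /f ruleK.
  + apply/trivIsetP => _ _ /imsetP[c _ ->] /imsetP[c' _ ->] neq.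
    rewrite disjoint_subset; apply/subsetP => -[x y] in_c; apply/negP => in_c'.
    by move: neq; rewrite (C_disj _ _ _ _ in_c in_c') eqxx.
  + apply/imsetP => -[c _ C0]; have := memC c 0 (f c 0).
    by rewrite -C0 inE eqxx.
- by rewrite card_imset // card_ord.
move=> _ /imsetP[c _ ->]; exists (orbit (f c) 0).
have f_inj := single_orbit_inj (rule_orb c).
have in_orb x : x \in orbit (f c) 0 by rewrite -fconnect_orbit; apply: rule_orb.
split=> //.
  rewrite /ucycle orbit_uniq andbT.
  apply: sub_cycle (cycle_orbit f_inj 0) => x y /eqP <-.
  by apply/torus_arcsP; exists (rule x c).
apply/setP => -[x y]; rewrite memC; apply/eqP/imsetP => [->|[z _ [-> ->]]].
  by exists x; rewrite // (nextE (cycle_orbit f_inj 0)).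
by rewrite (nextE (cycle_orbit f_inj 0)).
Qed.

End Torus.

(** * Products of two copies *)

Definition sum_step (X D : finType) (step : D -> X -> X) (d : D + D)
    (x : X * X) : X * X :=
  match d with
  | inl i => (step i x.1, x.2)
  | inr i => (x.1, step i x.2)
  end.

Section Diagonal.

Variables (X : finType) (f : X -> X) (x0 : X).
Hypothesis orbf : single_orbit f.
Notation N := #|X|.
Notation pos := (orbit_pos f x0).

Definition diagonal (x : X * X) : bool := N %| pos x.1 + pos x.2.

(** The square of a directed cycle of length [N] is decomposed by exchanging
    the two directions on the antidiagonal. A path of the first colour runs
    along its row to the antidiagonal, climbs by one there, and so enters the
    next row at the only point that is one step beyond the antidiagonal of
    that row: each row is traversed completely before the next one. *)
Definition stairs (x : X * X) : X * X :=
  if diagonal x then (x.1, f x.2) else (f x.1, x.2).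

Lemma stairs_inj : injective stairs.
Proof.
have f_inj := single_orbit_inj orbf.
(* both kinds of arcs enter different classes of pos v + pos w modulo N *)
have clash v w v' w' : diagonal (v, w) -> ~~ diagonal (v', w') ->
    (v, f w) <> (f v', w').
  rewrite /diagonal /= => d1 /negP d2 [Ev Ew]; apply: d2.
  move: d1; rewrite Ev -Ew (pos_next x0 v' orbf) (pos_next x0 w orbf).
  by rewrite /dvdn modnDml modnDmr addSn addnS.
move=> [v w] [v' w']; rewrite /stairs /=.
case: ifPn => d1; case: ifPn => d2 E.
- by case: E => -> /f_inj ->.
- by case: (clash _ _ _ _ d1 d2 E).
- by case: (clash _ _ _ _ d2 d1 (esym E)).
- by case: E => /f_inj -> ->.
Qed.

Lemma stairs_single_orbit : single_orbit stairs.
Proof.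
have Rtrans : transitive (fconnect stairs) by apply: connect_trans.
have row v w : exists2 u, diagonal (u, w) & fconnect stairs (v, w) (u, w).
  apply: (@run_until _ f (fun u => diagonal (u, w))
            (fun u u' => fconnect stairs (u, w) (u', w)) v) => [u|x y z|| u d].
  - exact: connect0.
  - exact: Rtrans.
  - have N_gt0 : 0 < N by apply/card_gt0P; exists v.
    have [n Hn] : exists n, iter n f v = orbit_pt f x0 (N - pos w).
      by exists (findex f v (orbit_pt f x0 (N - pos w))); rewrite iter_findex.
    exists n; rewrite Hn /diagonal /=.
    case E : (pos w) => [|p]; first by rewrite subn0 -[N]add0n pt_period // pos0 dvdn0.
    have ltw := pos_lt x0 orbf w.
    have ltp : p < N by rewrite E in ltw; apply: ltnW.
    rewrite ptK ?subnK ?dvdnn //. by rewrite ltn_subrL N_gt0.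
  by have := fconnect1 stairs (u, w); rewrite {2}/stairs /= (negPf d).
apply: (single_orbitI (x0 := (x0, x0)) stairs_inj) => -[v w].
have [u] : exists u, fconnect stairs (v, w) (u, x0).
  have [n Hn] : exists n, iter n f w = x0 by exists (findex f w x0); rewrite iter_findex.
  elim: n v w Hn => [|n IHn] v w; first by move=> /= ->; exists v; apply: connect0.
  rewrite iterSr => /IHn IH; have [u d Ru] := row v w.
  have [u' Ru'] := IH u; exists u'; apply: (connect_trans Ru); apply: (connect_trans _ Ru').
  by have := fconnect1 stairs (u, w); rewrite {2}/stairs d.
move=> Ru; apply: (connect_trans Ru); have [u' d Ru0] := row u x0.
suff u'0 : u' = x0 by rewrite u'0 in Ru0.
move: d; rewrite /diagonal /= pos0 addn0 => /dvdnP[[|q] E].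
  by rewrite -(posK x0 orbf u') E.
by have := pos_lt x0 orbf u'; rewrite E mulSn ltnNge leq_addr.
Qed.

End Diagonal.

(** The product of two copies of a digraph is the arc-disjoint union, over the
    Hamilton cycles of one copy, of the squares of these cycles. *)
Lemma ham_decomposable_square (X D : finType) (x0 : X) (step : D -> X -> X) :
  ham_decomposable step -> ham_decomposable (sum_step step).
Proof.
case=> rule [rule_inj rule_orb].
pose f c x := step (rule x c) x.
apply: (@ham_decomposable_refine _ _ _ (sum_step f)
  (fun x d => match d with inl i => inl (rule x.1 i) | inr i => inr (rule x.2 i) end)).
- by move=> x [i|i] [j|j] // [] /rule_inj ->.
- by move=> [i|i] x.
exists (fun x d => match d with
  | inl i => if diagonal (f i) x0 x then inr i else inl i
  | inr i => if diagonal (f i) x0 x then inl i else inr i end); split.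
- by move=> x [i|i] [j|j] /=; do 2?case: ifPn; move=> d1 d2 [E]; rewrite ?E // in d1 d2 *;
     rewrite ?d1 ?(negPf d1) in d2.
move=> [i|i].
  apply: eq_single_orbit (stairs_single_orbit x0 (rule_orb i)) => x.
  by rewrite /stairs -/(f i); case: ifP.
apply: (@single_orbit_transport _ _ (fun x : X * X => (x.2, x.1))
  (fun x => (x.2, x.1)) _ _ _ _ (stairs_single_orbit x0 (rule_orb i))).
  by case.
move=> [v w]; rewrite /stairs /diagonal -/(f i) /= [orbit_pos _ _ w + _]addnC.
by case: ifP.
Qed.

(** * Layers *)

Section Layers.

Import GRing.Theory.

Fixpoint layers (Y : Type) (L : nat -> Y -> Y) (n : nat) (y : Y) : Y :=
  if n is n'.+1 then L n' (layers L n' y) else y.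

Variables (m : nat) (Y : finType) (L : nat -> Y -> Y).
Hypothesis m_gt1 : 1 < m.

Definition layered_map (x : 'Z_m * Y) : 'Z_m * Y := ((x.1 + 1)%R, L x.1 x.2).

Lemma val_Zp_succ (t : 'Z_m) : ((t + 1)%R : nat) = t.+1 %% m.
Proof.
transitivity (t.+1 %% (Zp_trunc m).+2); first by rewrite /= modnDmr addn1.
by congr (_ %% _); exact: Zp_cast.
Qed.

Lemma layered_mapE t y : layered_map (t, y) = ((t + 1)%R, L t y).
Proof. by []. Qed.

(** Every orbit visits layer [0] once per lap of the layers, and the map of
    first return to layer [0] is [layers L m]. *)
Lemma layered_single_orbit :
  single_orbit (layers L m) -> single_orbit layered_map.
Proof.
move=> orb; have comp_inj := single_orbit_inj orb.
have layers_inj n : n <= m -> injective (layers L n).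
  move=> le_nm x y eq_xy; apply: comp_inj.
  rewrite -(subnK le_nm); elim: (m - n) => // d IHd.
  by rewrite addSn /= IHd.
have from0 n y : n < m -> iter n layered_map (0%R, y) = (inord n, layers L n y).
  have cast : (Zp_trunc m).+2 = m by apply: Zp_cast.
  elim: n => [|n IHn] lt_nm.
    by congr (_, _); apply: val_inj; rewrite /= inordK.
  have ltn := ltnW lt_nm.
  rewrite iterS IHn // layered_mapE inordK ?cast //.
  congr (_, _); apply: ord_inj; rewrite val_Zp_succ !inordK ?cast //.
  by rewrite modn_small.
have lap y : iter m layered_map (0%R, y) = (0%R, layers L m y).
  have [p Ep] : exists p, m = p.+1 by exists m.-1; rewrite prednK // ltnW.
  have ltp : p < m by rewrite Ep.
  have -> : iter m layered_map (0%R, y) = layered_map (iter p layered_map (0%R, y)).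
    by rewrite -iterS -Ep.
  have -> : layers L m y = L p (layers L p y) by rewrite Ep.
  rewrite from0 // layered_mapE inordK ?Zp_cast //.
  congr (_, _); apply: ord_inj.
  by rewrite val_Zp_succ inordK ?Zp_cast // -Ep modnn.
have laps n y : iter (n * m) layered_map (0%R, y) = (0%R, iter n (layers L m) y).
  by elim: n y => //= n IHn y; rewrite mulSn iterD IHn lap.
have to0 : forall x, exists n y, iter n layered_map x = (0%R, y).
  case=> t y; have lt_tm : t < m by rewrite -[X in _ < X](Zp_cast m_gt1).
  have [d] := ubnP (m - t); elim: d t lt_tm y => // d IHd t lt_tm y le_d.
  have [eq_tm|neq_tm] := eqVneq t.+1 m.
    exists 1, (L t y); rewrite [iter 1 _ _]layered_mapE; congr (_, _); apply: ord_inj.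
    by rewrite val_Zp_succ eq_tm modnn.
  have ltS : t.+1 < m by rewrite ltn_neqAle neq_tm.
  have valS : ((t + 1)%R : nat) = t.+1 by rewrite val_Zp_succ modn_small.
  have [||n [y' Hn]] := IHd (t + 1)%R _ (L t y); rewrite ?valS //; first by lia.
  by exists n.+1, y'; rewrite iterSr.
apply: single_orbit_iter => x [t z].
have [n [y Hn]] := to0 x.
have lt_tm : t < m by rewrite -[X in _ < X](Zp_cast m_gt1).
have [g _ gK] := injF_bij (layers_inj t (ltnW lt_tm)).
exists (t + (findex (layers L m) y (g z) * m + n)).
by rewrite !iterD Hn laps iter_findex // from0 // gK inord_val.
Qed.

End Layers.

Lemma eq_layers (Y : Type) (L L' : nat -> Y -> Y) n :
  (forall t, L t =1 L' t) -> layers L n =1 layers L' n.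
Proof. by move=> E; elim: n => //= n IHn y; rewrite IHn E. Qed.

Lemma layers_tail (Y : Type) (L : nat -> Y -> Y) (G : Y -> Y) (j n : nat) y :
  (forall t, j <= t -> L t =1 G) ->
  layers L (n + j) y = iter n G (layers L j y).
Proof.
by move=> LG; elim: n => //= n ->; rewrite LG // leq_addl.
Qed.

(** * One cycle and two copies *)

Section OddProduct.

Import GRing.Theory.

Definition odd_step (m : nat) (V I : finType) (step : I -> V -> V)
    (d : option (I + I)) (x : 'Z_m * (V * V)) : 'Z_m * (V * V) :=
  if d is Some e then (x.1, sum_step step e x.2) else ((x.1 + 1)%R, x.2).

(** What remains of an arc once the layer is forgotten: the arcs of the
    directed cycle become loops. *)
Definition stay_step (V I : finType) (step : I -> V -> V)
    (d : option (I + I)) (y : V * V) : V * V :=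
  if d is Some e then sum_step step e y else y.

(** A potential that every arc increases by one, as the sum of the coordinates
    does on the torus. It cuts a product into layers. *)
Definition graded (m : nat) (V I : finType) (step : I -> V -> V)
    (h : V -> 'Z_m) : Prop :=
  forall i v, h (step i v) = (h v + 1)%R.

Lemma odd_step_refine (m : nat) (V I : finType) (step : I -> V -> V)
    (rule : V -> I -> I) :
  (forall v, injective (rule v)) ->
  ham_decomposable (@odd_step m V I (fun i v => step (rule v i) v)) ->
  ham_decomposable (@odd_step m V I step).
Proof.
move=> rule_inj.
pose tau (x : 'Z_m * (V * V)) (d : option (I + I)) : option (I + I) :=
  match d with
  | None => None
  | Some (inl i) => Some (inl (rule x.2.1 i))
  | Some (inr i) => Some (inr (rule x.2.2 i))
  end.
apply: (@ham_decomposable_refine _ _ _ _ tau).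
  by move=> x [[i|i]|] [[j|j]|] //= [] /rule_inj ->.
by move=> [[i|i]|] [s [v w]].
Qed.

(** The total potential [x0 + h v + h w] increases by one along every arc, and
    together with [v] and [w] it determines [x0]. In these coordinates a rule
    that depends on the layer and on [(v, w)] only is a layered map. *)
Lemma odd_step_layers (m : nat) (V I : finType) (step : I -> V -> V)
    (h : V -> 'Z_m) (rule : nat -> V * V -> option (I + I) -> option (I + I)) :
  1 < m -> graded step h -> (forall t y, injective (rule t y)) ->
  (forall c, single_orbit (layers (fun t y => stay_step step (rule t y c) y) m)) ->
  ham_decomposable (@odd_step m V I step).
Proof.
move=> m_gt1 hstep rule_inj orb.
pose lev (x : 'Z_m * (V * V)) : 'Z_m := (x.1 + h x.2.1 + h x.2.2)%R.
pose phi (x : 'Z_m * (V * V)) := (lev x, x.2).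
pose psi (x : 'Z_m * (V * V)) := ((x.1 - h x.2.2 - h x.2.1)%R, x.2).
have phiK : cancel phi psi.
  by move=> [s [v w]]; rewrite /phi /psi /lev /= !addrK.
have psiK : cancel psi phi.
  by move=> [s [v w]]; rewrite /phi /psi /lev /= !subrK.
exists (fun x => rule (lev x) x.2); split=> // c.
apply: single_orbit_transport phiK _ (layered_single_orbit m_gt1 (orb c)).
move=> [s [v w]]; rewrite layered_mapE.
have -> : lev (psi (s, (v, w))) = s by have [->] := psiK (s, (v, w)).
have -> : (psi (s, (v, w))).2 = (v, w) by [].
case: (rule _ _ c) => [[i|i]|] /=; rewrite /psi /= ?hstep; congr (_, _).
- by ring.
- by ring.
by ring.
Qed.

Definition coord_sum (m k : nat) (v : 'rV['Z_m]_k) : 'Z_m := (\sum_i v ord0 i)%R.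

Lemma coord_sum_graded (m k : nat) : graded (@torus_step m k) (@coord_sum m k).
Proof.
move=> i v; rewrite /coord_sum.
under eq_bigr do rewrite !mxE eqxx /=.
rewrite big_split /=; congr (_ + _)%R.
by rewrite (bigD1 i) //= eqxx big1 ?addr0 // => j /negPf ->.
Qed.

Lemma ham_decomposable_odd_torus (m k : nat) :
  ham_decomposable (@odd_step m _ _ (@torus_step m k)) ->
  ham_decomposable (@torus_step m (1 + (k + k))).
Proof.
pose phi (x : 'Z_m * ('rV['Z_m]_k * 'rV['Z_m]_k)) : 'rV['Z_m]_(1 + (k + k)) :=
  row_mx (const_mx x.1) (row_mx x.2.1 x.2.2).
pose psi (x : 'rV['Z_m]_(1 + (k + k))) :=
  (lsubmx x ord0 ord0, (lsubmx (rsubmx x), rsubmx (rsubmx x))).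
pose iota (d : option ('I_k + 'I_k)) : 'I_(1 + (k + k)) :=
  match d with
  | None => lshift _ ord0
  | Some (inl i) => rshift 1 (lshift k i)
  | Some (inr i) => rshift 1 (rshift k i)
  end.
pose kappa (d : 'I_(1 + (k + k))) : option ('I_k + 'I_k) :=
  if split d is inr e then Some (split e) else None.
apply: (@ham_decomposable_transport _ _ _ _ _ _ phi psi iota kappa).
- move=> x; rewrite /phi /psi /= hsubmxK -[RHS]hsubmxK; congr row_mx.
  by apply/matrixP => i j; rewrite !ord1 mxE.
- by move=> [s [v w]]; rewrite /phi /psi /= !(row_mxKl, row_mxKr) mxE.
- have splitL p q (i : 'I_p) : split (lshift q i) = inl i := unsplitK (inl i).
  have splitR p q (i : 'I_q) : split (rshift p i) = inr i := unsplitK (inr i).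
  by move=> [[i|i]|]; rewrite /iota /kappa ?splitR ?splitL.
- move=> d; rewrite /iota /kappa; case: (split_ordP d) => [j|e] -> /=.
    by rewrite (ord1 j).
  by case: (split_ordP e) => i ->.
move=> [[i|i]|] [s [v w]]; rewrite /phi /iota /odd_step /torus_step /=.
- rewrite delta_mx_rshift delta_mx_lshift !add_row_mx !addr0.
  by [].
- by rewrite !delta_mx_rshift !add_row_mx !addr0.
rewrite delta_mx_lshift add_row_mx addr0; congr row_mx.
by apply/matrixP => i j; rewrite !ord1 !mxE !eqxx.
Qed.

End OddProduct.

(** * The colours of an odd product *)

(** Directions are coded by numbers: 0 for the arc of the directed cycle, 1 and
    2 for the arcs of the distinguished Hamilton cycle of the first and of the
    second copy. A triple lists the directions of the first, the second and the
    third colour. *)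
Definition perm3 (p : nat * nat * nat) : bool :=
  p \in [:: (0, 1, 2); (0, 2, 1); (1, 0, 2); (1, 2, 0); (2, 0, 1); (2, 1, 0)].

Definition tri_step (V : Type) (g : V -> V) (n : nat) (y : V * V) : V * V :=
  match n with
  | 0 => y
  | 1 => (g y.1, y.2)
  | _ => (y.1, g y.2)
  end.

(** The arcs of the product of a directed cycle with two copies of [V], where
    [V] is decomposed by [f], receive [2 k + 3] colours: one for the directed
    cycle and two for every [f i]. The colours attached to [ord0] and the first
    one form a triple, and [tri] says how they share three arcs. For [i] other
    than [ord0] the two colours of [i] follow [f i], one in each copy, and
    exchange the copies in layer 1. With this alone, one coordinate would
    advance by a multiple of [#|V|] while the other one goes once around its
    cycle, and the colour would fall apart into short cycles. So in a special
    row of index [i], where the first colour stays put, it takes the arc [f i]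
    of the first copy, and the colour that loses this arc stays put instead. *)
Section ThreeColours.

Variables (m : nat) (V : finType) (k : nat) (f : 'I_k.+1 -> V -> V).
Variables (h : V -> 'Z_m) (tri : nat -> V * V -> nat * nat * nat).
Variable sp : nat -> V -> option 'I_k.+1.
Hypothesis m_ge3 : 3 <= m.
Hypothesis f_graded : graded f h.
Hypothesis f_orb : forall i, single_orbit (f i).
Hypothesis cop_m : coprime m.-1 #|V|.
Hypothesis tri_perm : forall t y, perm3 (tri t y).
Hypothesis sp_layer : forall t w, t != 1 -> t != 2 -> sp t w = None.
Hypothesis sp_tri : forall t y i, sp t y.2 = Some i -> (tri t y).1.1 = 0.
Hypothesis sp_card : forall i t, i != ord0 -> t \in [:: 1; 2] ->
  coprime #|[pred w | sp t w == Some i]| #|V|.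
Hypothesis sp_neq0 : forall t w i, sp t w = Some i -> i != ord0.

Definition dir3 (n : nat) : option ('I_k.+1 + 'I_k.+1) :=
  match n with
  | 0 => None
  | 1 => Some (inl ord0)
  | _ => Some (inr ord0)
  end.

Definition base_rule t (y : V * V) (c : option ('I_k.+1 + 'I_k.+1)) :=
  match c with
  | None => dir3 (tri t y).1.1
  | Some (inl i) => if i == ord0 then dir3 (tri t y).1.2
                    else Some (if t == 1 then inr i else inl i)
  | Some (inr i) => if i == ord0 then dir3 (tri t y).2
                    else Some (if t == 1 then inl i else inr i)
  end.

Definition odd_rule t (y : V * V) (c : option ('I_k.+1 + 'I_k.+1)) :=
  if sp t y.2 is Some i then tperm None (Some (inl i)) (base_rule t y c)
  else base_rule t y c.

Lemma base_rule_inj t y : injective (base_rule t y).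
Proof.
have := tri_perm t y; rewrite /base_rule /perm3 !inE.
by case: (t == 1); (do 5?case/orP); move/eqP => -> /= [[i|i]|] [[j|j]|];
  do 2?case: eqP; congruence.
Qed.

Lemma odd_rule_inj t y : injective (odd_rule t y).
Proof.
rewrite /odd_rule; case: (sp t y.2) => [i|]; last exact: base_rule_inj.
exact: inj_comp (@perm_inj _ _) (@base_rule_inj t y).
Qed.

(** The layer maps of the first colour; those of the two other colours of the
    triple are the maps [tri_step], see [odd_rule_second] and
    [odd_rule_third]. *)
Definition first_layer t (y : V * V) : V * V :=
  if sp t y.2 is Some i then (f i y.1, y.2)
  else tri_step (f ord0) (tri t y).1.1 y.

Lemma stay_dir3 n y : stay_step f (dir3 n) y = tri_step (f ord0) n y.
Proof. by case: y n => v w [|[|n]]. Qed.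

Lemma odd_rule_first t y :
  stay_step f (odd_rule t y None) y = first_layer t y.
Proof.
rewrite /odd_rule /first_layer /=; case Esp: (sp t y.2) => [i|].
  by rewrite (sp_tri Esp) tpermL; case: (y).
exact: stay_dir3.
Qed.

Lemma tperm_dir3 t w i n :
  sp t w = Some i -> n != 0 -> tperm None (Some (inl i)) (dir3 n) = dir3 n.
Proof.
move=> /sp_neq0 i_neq0 n_neq0; rewrite tpermD //; case: n n_neq0 => [|[|n]] //= _.
Qed.

Lemma perm3_first0 p : perm3 p -> p.1.1 = 0 -> p.1.2 != 0 /\ p.2 != 0.
Proof. by rewrite /perm3 !inE; do 5?case/orP; move/eqP => ->. Qed.

Lemma odd_rule_second t y :
  stay_step f (odd_rule t y (Some (inl ord0))) y =
  tri_step (f ord0) (tri t y).1.2 y.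
Proof.
rewrite /odd_rule /=; case Esp: (sp t y.2) => [i|]; last exact: stay_dir3.
have [n2 _] := perm3_first0 (tri_perm t y) (sp_tri Esp).
by rewrite (tperm_dir3 Esp n2) stay_dir3.
Qed.

Lemma odd_rule_third t y :
  stay_step f (odd_rule t y (Some (inr ord0))) y =
  tri_step (f ord0) (tri t y).2 y.
Proof.
rewrite /odd_rule /=; case Esp: (sp t y.2) => [i|]; last exact: stay_dir3.
have [_ n3] := perm3_first0 (tri_perm t y) (sp_tri Esp).
by rewrite (tperm_dir3 Esp n3) stay_dir3.
Qed.

Lemma odd_rule_pair1 t y i : i != ord0 ->
  stay_step f (odd_rule t y (Some (inl i))) y =
  if t == 1 then (y.1, f i y.2)
  else if sp t y.2 == Some i then y else (f i y.1, y.2).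
Proof.
move=> i_neq0; rewrite /odd_rule /= (negPf i_neq0).
case: eqP => t1; case Esp: (sp t y.2) => [j|] //; first by rewrite tpermD.
have [->|ne] := eqVneq j i; first by rewrite tpermR eqxx.
by rewrite tpermD //= ifN.
Qed.

Lemma odd_rule_pair2 t y i : i != ord0 ->
  stay_step f (odd_rule t y (Some (inr i))) y =
  if t == 1 then (if sp t y.2 == Some i then y else (f i y.1, y.2))
  else (y.1, f i y.2).
Proof.
move=> i_neq0; rewrite /odd_rule /= (negPf i_neq0).
case: eqP => t1; case Esp: (sp t y.2) => [j|] //; last by rewrite tpermD.
have [->|ne] := eqVneq j i; first by rewrite tpermR eqxx.
by rewrite tpermD //= ifN.
Qed.

Lemma iter_fst (g : V -> V) n v w :
  iter n (fun y : V * V => (g y.1, y.2)) (v, w) = (iter n g v, w).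
Proof. by elim: n => //= n ->. Qed.

Lemma iter_snd (g : V -> V) n v w :
  iter n (fun y : V * V => (y.1, g y.2)) (v, w) = (v, iter n g w).
Proof. by elim: n => //= n ->. Qed.

Lemma sum_indicator (P : pred V) : \sum_w (P w : nat) = #|P|.
Proof. by rewrite -sum1_card [RHS]big_mkcond; apply: eq_bigr => w _; rewrite unfold_in; case: (P w). Qed.

Lemma coprime_sub_card (P : pred V) n :
  n * #|V| >= #|P| -> coprime #|P| #|V| -> coprime (n * #|V| - #|P|) #|V|.
Proof.
move=> le /eqP cop; rewrite /coprime -dvdn1 -[X in _ %| X]cop dvdn_gcd dvdn_gcdr.
by rewrite -(dvdn_addr _ (dvdn_gcdl _ #|V|)) subnK // dvdn_mull // dvdn_gcdr.
Qed.

(** A lap is a skew product: the second coordinate moves by [f i], and the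
    first one by [m - 1] steps, less one in the special rows of layer 2. Summed
    over all rows this is prime to [#|V|] since the number of those special
    rows is. *)
Lemma pair1_orbit i : i != ord0 ->
  single_orbit (layers (fun t y => stay_step f (odd_rule t y (Some (inl i))) y) m).
Proof.
move=> i_neq0.
pose phi w := m.-1 - (sp 2 (f i w) == Some i).
have phi_sum : \sum_w phi w = m.-1 * #|V| - #|[pred w | sp 2 w == Some i]|.
  rewrite sumnB => [|w _]; last by case: eqP; lia.
  rewrite sum_nat_const mulnC; congr (_ - _).
  by rewrite -sum_indicator [RHS](reindex_inj (single_orbit_inj (f_orb i))).
have phi_cop : coprime (\sum_w phi w) #|V|.
  rewrite phi_sum coprime_sub_card ?sp_card //.
  by apply: leq_trans (max_card _) _; rewrite leq_pmull //; lia.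
apply: eq_single_orbit (single_orbit_skew (f_orb i) (f_orb i) phi_cop) => -[v w].
have {1}-> : m = (m - 3) + 3 by lia.
rewrite (@layers_tail _ _ (fun y => (f i y.1, y.2))); last first.
  by move=> t le_t y; rewrite odd_rule_pair1 // sp_layer ?ifN_eq //; lia.
rewrite /layers !odd_rule_pair1 //= !(@sp_layer 0) //= /phi.
by case: eqP => _; rewrite iter_fst /= -?iterSr -?iterS; congr (iter _ _ _, _); lia.
Qed.

(** The same with the special rows of layer 1: the second coordinate moves by
    [m - 1] steps, and the first one by one step outside the special rows. *)
Lemma pair2_orbit i : i != ord0 ->
  single_orbit (layers (fun t y => stay_step f (odd_rule t y (Some (inr i))) y) m).
Proof.
move=> i_neq0.
pose phi w := 1 - (sp 1 (f i w) == Some i).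
have phi_sum : \sum_w phi w = 1 * #|V| - #|[pred w | sp 1 w == Some i]|.
  rewrite sumnB => [|w _]; last by case: eqP.
  rewrite sum_nat_const mulnC; congr (_ - _).
  by rewrite -sum_indicator [RHS](reindex_inj (single_orbit_inj (f_orb i))).
have phi_cop : coprime (\sum_w phi w) #|V|.
  by rewrite phi_sum coprime_sub_card ?sp_card // mul1n max_card.
apply: eq_single_orbit (single_orbit_skew (f_orb i)
  (single_orbit_expn (f_orb i) cop_m) phi_cop) => -[v w].
have -> : m = (m - 3) + 3 by lia.
rewrite (@layers_tail _ _ (fun y => (y.1, f i y.2))); last first.
  by move=> t le_t y; rewrite odd_rule_pair2 // ifN_eq //; lia.
rewrite /layers !odd_rule_pair2 //= /phi.
by case: eqP => _; rewrite iter_snd /= -?iterSr -?iterS; congr (_, iter _ _ _); lia.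
Qed.

Lemma odd_decomposable :
  single_orbit (layers first_layer m) ->
  single_orbit (layers (fun t y => tri_step (f ord0) (tri t y).1.2 y) m) ->
  single_orbit (layers (fun t y => tri_step (f ord0) (tri t y).2 y) m) ->
  ham_decomposable (@odd_step m V _ f).
Proof.
move=> orb1 orb2 orb3.
apply: (odd_step_layers (rule := odd_rule) _ f_graded odd_rule_inj); first by lia.
move=> [[i|i]|].
- have [->|i_neq0] := eqVneq i ord0; last exact: pair1_orbit.
  by apply: eq_single_orbit orb2; apply: eq_layers => t y; rewrite odd_rule_second.
- have [->|i_neq0] := eqVneq i ord0; last exact: pair2_orbit.
  by apply: eq_single_orbit orb3; apply: eq_layers => t y; rewrite odd_rule_third.
by apply: eq_single_orbit orb1; apply: eq_layers => t y; rewrite odd_rule_first.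
Qed.

End ThreeColours.

Lemma single_orbit_skew_r (V W : finType) (f : V -> V) (g : W -> W)
    (phi : W -> nat) :
  single_orbit f -> single_orbit g -> coprime (\sum_w phi w) #|V| ->
  single_orbit (fun x : W * V => (g x.1, iter (phi x.1) f x.2)).
Proof.
move=> orbf orbg cop.
by apply: (@single_orbit_transport _ _ (fun x => (x.2, x.1)) (fun x => (x.2, x.1))
  _ _ _ _ (single_orbit_skew orbf orbg cop)) => -[].
Qed.

Lemma card_pos_interval (V : finType) (g : V -> V) (x0 : V) a b :
  single_orbit g -> b <= #|V| ->
  #|[pred w | a <= orbit_pos g x0 w < b]| = b - a.
Proof.
move=> orbg le_bN; rewrite -[RHS]card_ord.
have lt_N (j : 'I_(b - a)) : a + j < #|V| by have := ltn_ord j; lia.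
have inj_pt : injective (fun j : 'I_(b - a) => orbit_pt g x0 (a + j)).
  move=> i j eq_ij; apply: ord_inj; apply: (@addnI a).
  by rewrite -(ptK x0 orbg (lt_N i)) eq_ij (ptK x0 orbg (lt_N j)).
rewrite -(card_image inj_pt); apply: eq_card => w; rewrite !inE.
apply/idP/imageP => [/andP[ge_a lt_b]|[j _ ->]].
  have lt_j : orbit_pos g x0 w - a < b - a by lia.
  by exists (Ordinal lt_j) => //=; rewrite subnKC // (posK x0 orbg).
by rewrite (ptK x0 orbg (lt_N j)); have := ltn_ord j; lia.
Qed.

(** * Special rows *)

(** The special rows are the first [2 m k + 2] ones, counted along the cycle
    [f ord0]. Each index [i] from 1 to [k] receives a block of [2 m]
    consecutive rows, of which the first serves in layer 2 and the others in
    layer 1; the two rows left over are given to index 1 in layer 1. Hence the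
    number of special rows of given index and layer is 1, [2 m - 1] or
    [2 m + 1], always prime to [m], while their total [2 m k + 2] is prime
    to [m] when [m] is odd, and twice a number prime to [m] in any case. *)
Section SpecialRows.

Variables (m : nat) (V : finType) (k : nat) (f : 'I_k.+1 -> V -> V) (x0 : V).
Hypothesis m_ge3 : 3 <= m.
Hypothesis k_gt0 : 0 < k.
Hypothesis cardV : #|V| = m ^ k.+1.
Hypothesis f_orb : forall i, single_orbit (f i).
Notation g := (f ord0).
Notation pos := (orbit_pos g x0).
Notation N := #|V|.

Definition num_special := 2 * m * k + 2.

Definition sp_index r := if r < 2 * m * k then (r %/ (2 * m)).+1 else 1.

Definition sp_layer r :=
  if (r < 2 * m * k) && (r %% (2 * m) == 0) then 2 else 1.

Definition special_row t (w : V) : option 'I_k.+1 :=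
  if (pos w < num_special) && (t == sp_layer (pos w))
  then Some (inord (sp_index (pos w))) else None.

Lemma sp_index_bound r : 0 < sp_index r <= k.
Proof.
rewrite /sp_index; case: ifP => ltr; last by lia.
by rewrite /= ltn_divLR ?[k * _]mulnC //; lia.
Qed.

Lemma special_neq0 t w i : special_row t w = Some i -> i != ord0.
Proof.
rewrite /special_row; case: ifP => // _ [<-].
have := sp_index_bound (pos w) => /andP[gt0 lek].
by apply/eqP => /(congr1 val) /=; rewrite inordK; lia.
Qed.

Lemma special_layer t w : t != 1 -> t != 2 -> special_row t w = None.
Proof.
by rewrite /special_row /sp_layer => /negPf t1 /negPf t2; case: (_ && (_ == 0));
  rewrite ?t1 ?t2 andbF.
Qed.

Lemma specialP t w (i : 'I_k.+1) :
  (special_row t w == Some i) =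
  [&& pos w < num_special, t == sp_layer (pos w) & sp_index (pos w) == i].
Proof.
rewrite /special_row andbA; case: ifP => //= _.
have /andP[_ lek] := sp_index_bound (pos w).
apply/eqP/eqP => [[<-]|E]; first by rewrite inordK.
by congr Some; apply: ord_inj; rewrite inordK.
Qed.

Lemma num_special_le : num_special <= N.
Proof.
rewrite cardV /num_special.
case: (k) k_gt0 => // k' _; elim: k' => [|k' IHk]; first by rewrite !expnS; nia.
by rewrite expnS; nia.
Qed.

Lemma coprime_N a : coprime a m -> coprime a N.
Proof. by rewrite cardV; apply: coprimeXr. Qed.

Lemma card_special2 i : i != ord0 -> #|[pred w | special_row 2 w == Some i]| = 1.
Proof.
move=> i_neq0; have i_gt0 : 0 < i by rewrite lt0n.
have ltik := ltn_ord i; have leN := num_special_le.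
have le_i : 2 * m * i.-1.+1 <= 2 * m * k by rewrite leq_mul2l; lia.
rewrite mulnS in le_i.
transitivity #|[pred w | 2 * m * i.-1 <= pos w < (2 * m * i.-1).+1]|.
  apply: eq_card => w; rewrite !inE specialP /sp_layer /sp_index.
  rewrite /num_special in leN; rewrite /num_special.
  have -> : (2 * m * i.-1 <= pos w < (2 * m * i.-1).+1) = (pos w == i.-1 * (2 * m)).
    by rewrite mulnC; lia.
  case: (ltnP (pos w) (2 * m * k)) => lt_r /=; last first.
    by rewrite andbF; apply/esym/negbTE; lia.
  have -> /= : pos w < 2 * m * k + 2 by lia.
  apply/andP/eqP => [[]|E].
    case: (_ %% _ =P 0) => // r0 _ /eqP <-.
    by have := divn_eq (pos w) (2 * m); rewrite r0 addn0.
  by rewrite E modnMl mulnK ?eqxx //; lia.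
by rewrite card_pos_interval //; rewrite /num_special in leN; lia.
Qed.

Lemma card_special1 i : i != ord0 ->
  #|[pred w | special_row 1 w == Some i]| = if i == 1 :> nat then 2 * m + 1 else 2 * m - 1.
Proof.
move=> i_neq0; have i_gt0 : 0 < i by rewrite lt0n.
have ltik := ltn_ord i; have leN := num_special_le.
have le_i : 2 * m * i.-1.+1 <= 2 * m * k by rewrite leq_mul2l; lia.
rewrite mulnS in le_i; rewrite /num_special in leN.
pose A := [pred w | (2 * m * i.-1).+1 <= pos w < 2 * m * i.-1 + 2 * m].
pose B := [pred w | 2 * m * k <= pos w < 2 * m * k + (if i == 1 :> nat then 2 else 0)].
have cardA : #|A| = 2 * m - 1 by rewrite card_pos_interval //; lia.
have cardB : #|B| = if i == 1 :> nat then 2 else 0.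
  by rewrite card_pos_interval ?addKn //; case: ifP; lia.
transitivity #|predU A B|.
  apply: eq_card => w; rewrite !inE specialP /sp_layer /sp_index /num_special.
  case: (ltnP (pos w) (2 * m * k)) => lt_r /=; last first.
    by case: (eqVneq (i : nat) 1) => [E|ne]; [rewrite E in le_i *|]; lia.
  have -> /= : pos w < 2 * m * k + 2 by lia.
  rewrite orbF; have E := divn_eq (pos w) (2 * m).
  have := ltn_pmod (pos w) (_ : 0 < 2 * m).
  move: E; set q := pos w %/ (2 * m); set r := pos w %% (2 * m) => E ltr.
  have {}ltr : r < 2 * m by apply: ltr; lia.
  have -> : (1 == (if r == 0 then 2 else 1)) = (0 < r) by case: (r).
  rewrite E; have [eq_q|ne_q] := eqVneq q.+1 i.
    by rewrite -eq_q /= mulnC; lia.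
  rewrite andbF; apply/esym/negbTE.
  have [lt_q|gt_q] := ltnP q i.-1.
    have : q.+1 * (2 * m) <= i.-1 * (2 * m) by rewrite leq_mul2r; lia.
    by rewrite mulSn ![_ * (2 * m)]mulnC; lia.
  have : i.-1.+1 * (2 * m) <= q * (2 * m) by rewrite leq_mul2r; lia.
  by rewrite mulSn ![_ * (2 * m)]mulnC; lia.
have := cardUI A B; rewrite cardA cardB [#|predI A B|]eq_card0; last first.
  by move=> w; rewrite !inE; lia.
by rewrite addn0 => ->; case: ifP; lia.
Qed.

Lemma coprime_special i t : i != ord0 -> t \in [:: 1; 2] ->
  coprime #|[pred w | special_row t w == Some i]| N.
Proof.
move=> i_neq0; rewrite !inE => /orP[] /eqP ->; last first.
  by rewrite card_special2 // coprime1n.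
rewrite card_special1 //; apply: coprime_N; case: ifP => _.
  by rewrite coprime_sym /coprime gcdnMDl gcdn1.
rewrite (_ : 2 * m - 1 = m + m.-1); last by lia.
by rewrite coprime_sym /coprime gcdnDl -/(coprime _ _) coprimenP; lia.
Qed.

Lemma num_special_lt : 4 <= m -> num_special <= N - 2.
Proof.
rewrite cardV /num_special => m_ge4.
case: (k) k_gt0 => // k' _; elim: k' => [|k' IHk]; first by rewrite !expnS; nia.
by rewrite expnS; nia.
Qed.

Lemma four_mul_le_card : 4 <= m -> 4 * m <= N.
Proof.
rewrite cardV => m_ge4; case: (k) k_gt0 => // k' _; rewrite !expnS mulnA.
by rewrite -[X in X <= _]muln1 leq_mul ?leq_mul ?expn_gt0 //; lia.
Qed.

End SpecialRows.

(** Each row is run through by a cycle of its own, and column [v0] is a door to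
    the next row. An orbit meets the door of its row, is let into the next row,
    and returns to the door only after the whole of that row. *)
Lemma single_orbit_door (V : finType) (g : V -> V) (R : V -> V -> V) (v0 : V) :
  single_orbit g -> (forall w, single_orbit (R w)) ->
  single_orbit (fun y : V * V =>
    let w' := if y.1 == v0 then g y.2 else y.2 in (R w' y.1, w')).
Proof.
move=> orbg orbR; set F := fun _ => _.
have g_inj := single_orbit_inj orbg.
have R_inj w := single_orbit_inj (orbR w).
have F_inj : injective F.
  move=> [v w] [v' w'] [] /= Ev Ew; rewrite Ew in Ev.
  move/R_inj: Ev Ew => <-; case: ifP => _; first by move/g_inj ->.
  by move->.
have to_door v w : fconnect F (v, w) (v0, w).
  have [|x y z||u nu|u /eqP -> //] := @run_until _ (R w) (pred1 v0)
     (fun u u' => fconnect F (u, w) (u', w)) v.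
  - by move=> u; apply: connect0.
  - exact: connect_trans.
  - by exists (findex (R w) v v0); apply/eqP; apply: iter_findex (orbR w v v0).
  by have := fconnect1 F (u, w); rewrite {2}/F /= ifN.
have next_row w : fconnect F (v0, w) (v0, g w).
  apply: connect_trans (to_door (R (g w) v0) (g w)).
  by have := fconnect1 F (v0, w); rewrite {2}/F /= eqxx.
apply: (single_orbitI (x0 := (v0, v0))) F_inj _ => -[v w].
apply: connect_trans (to_door v w) _.
have rows n : fconnect F (v0, w) (v0, iter n g w).
  by elim: n => [|n IHn]; [apply: connect0|apply: connect_trans IHn (next_row _)].
by have := rows (findex g w v0); rewrite iter_findex.
Qed.

(** * Cycles of odd length, several pairs *)

Section OddLength.

Variables (m : nat) (V : finType) (k : nat) (f : 'I_k.+1 -> V -> V) (x0 : V).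
Variable h : V -> 'Z_m.
Hypothesis m_ge3 : 3 <= m.
Hypothesis m_odd : odd m.
Hypothesis k_gt0 : 0 < k.
Hypothesis cardV : #|V| = m ^ k.+1.
Hypothesis f_orb : forall i, single_orbit (f i).
Hypothesis f_graded : graded f h.
Notation g := (f ord0).
Notation pos := (orbit_pos g x0).
Notation N := #|V|.
Notation special := (special_row m f x0).

Definition odd_tri (t : nat) (y : V * V) : nat * nat * nat :=
  match t with
  | 0 => if y.1 == x0 then (2, 0, 1) else (0, 2, 1)
  | 1 => (0, 1, 2)
  | 2 => if pos y.2 < num_special m k then (0, 2, 1) else (1, 2, 0)
  | _ => (0, 2, 1)
  end.

Lemma odd_tri_perm t y : perm3 (odd_tri t y).
Proof. by case: t => [|[|[|t]]] //=; case: ifP. Qed.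

Lemma odd_tri_special t y i : special t y.2 = Some i -> (odd_tri t y).1.1 = 0.
Proof.
case: t => [|[|[|t]]] //=; rewrite /special_row; last by case: (pos y.2 < _).
by rewrite /sp_layer; case: (_ && (_ %% _ == _)); rewrite andbF.
Qed.

Let coprime_m1 : coprime m.-1 N.
Proof. by apply: (coprime_N cardV); rewrite coprimePn //; lia. Qed.

(** The rows are cycles, along [f i] in a special row of index [i] and along
    [f ord0] elsewhere, with a door at [x0]. *)
Lemma odd_first_orbit : single_orbit (layers (first_layer f odd_tri special) m).
Proof.
pose R w := if special 1 w is Some i then f i else
            if special 2 w is Some i then f i else g.
have orbR w : single_orbit (R w).
  by rewrite /R; case: (special 1 w) => //; case: (special 2 w).
apply: eq_single_orbit (single_orbit_door x0 (f_orb ord0) orbR) => -[v w].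
rewrite [X in layers _ X](_ : m = (m - 3) + 3); last by lia.
rewrite (@layers_tail _ _ id); last first.
  by move=> [|[|[|t]]] // _ [v' w']; rewrite /first_layer special_layer.
have -> y : iter (m - 3) id y = y by elim: (m - 3).
rewrite /layers {3}/first_layer special_layer //=.
set w' := if v == x0 then _ else _.
have -> : tri_step g (if v == x0 then (2, 0, 1) else (0, 2, 1)).1.1 (v, w) = (v, w').
  by rewrite /w'; case: ifP.
have L1 : first_layer f odd_tri special 1 (v, w') =
    (if special 1 w' is Some i then f i v else v, w').
  by rewrite /first_layer /=; case: (special 1 w').
have L2 v' : first_layer f odd_tri special 2 (v', w') =
    (if special 2 w' is Some i then f i v' else
     if pos w' < num_special m k then v' else g v', w').
  by rewrite /first_layer /=; case: (special 2 w') => //; case: ifP.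
rewrite L1 L2 /R /special_row; congr (_, _).
by rewrite /sp_layer; case: (pos w' < num_special m k) => //=; case: (_ && (_ %% _ == _)).
Qed.

(** A skew product over the first coordinate, with total [-1] modulo
    [#|V|]. *)
Lemma odd_second_orbit :
  single_orbit (layers (fun t y => tri_step g (odd_tri t y).1.2 y) m).
Proof.
pose phi v := m.-1 - (v == x0).
have phi_cop : coprime (\sum_v phi v) N.
  rewrite sumnB => [|v _]; last by case: eqP; lia.
  rewrite sum_nat_const mulnC (sum_indicator (pred1 x0)).
  by rewrite coprime_sub_card ?card1 ?coprime1n //; rewrite muln_gt0; apply/andP; split; [lia|apply/card_gt0P; exists x0].
apply: eq_single_orbit (single_orbit_skew_r (f_orb ord0) (f_orb ord0) phi_cop) => -[v w].
rewrite [X in layers _ X](_ : m = (m - 3) + 3); last by lia.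
rewrite (@layers_tail _ _ (fun y => (y.1, g y.2))); last by move=> [|[|[|t]]].
rewrite /layers /= /phi.
by case: (v == x0) => /=; case: (_ < num_special m k); rewrite iter_snd /= -?iterSr; congr (_, iter _ _ _); lia.
Qed.

(** A skew product over the second coordinate, with the number of special rows
    as total modulo [#|V|]; it is here that [m] has to be odd. *)
Lemma odd_third_orbit :
  single_orbit (layers (fun t y => tri_step g (odd_tri t y).2 y) m).
Proof.
pose phi w := m - 2 + (pos (g w) < num_special m k).
have phi_cop : coprime (\sum_w phi w) N.
  rewrite big_split sum_nat_const /= mulnC /coprime gcdnC gcdnMDl gcdnC.
  rewrite -(reindex_inj (single_orbit_inj (f_orb ord0)) (P := predT) (F := fun w => pos w < _ : nat)).
  rewrite (sum_indicator (fun w => pos w < num_special m k)).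
  have -> : #|[pred w | pos w < num_special m k]| = num_special m k.
    rewrite -[RHS]subn0 -(card_pos_interval x0 0 (f_orb ord0) (num_special_le m_ge3 k_gt0 cardV)).
    by apply: eq_card => w; rewrite !inE.
  apply: (coprime_N cardV); rewrite /num_special coprime_sym /coprime.
  by rewrite mulnAC gcdnMDl -/(coprime _ _) coprimen2.
apply: eq_single_orbit (single_orbit_skew (f_orb ord0) (f_orb ord0) phi_cop) => -[v w].
rewrite [X in layers _ X](_ : m = (m - 3) + 3); last by lia.
rewrite (@layers_tail _ _ (fun y => (g y.1, y.2))); last by move=> [|[|[|t]]].
rewrite /layers /=.
have -> : (if v == x0 then (2, 0, 1) else (0, 2, 1)).2 = 1 by case: ifP.
rewrite /= /phi.
by case: (_ < num_special m k); rewrite iter_fst /= -?iterSr; congr (iter _ _ _, _); lia.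
Qed.

Lemma odd_length_decomposable : ham_decomposable (@odd_step m V _ f).
Proof.
apply: (@odd_decomposable m V k f h odd_tri special) => //.
- exact: odd_tri_perm.
- by move=> t w; apply: special_layer.
- exact: odd_tri_special.
- by move=> i t; apply: coprime_special.
- by move=> t w i; apply: special_neq0.
- exact: odd_first_orbit.
- exact: odd_second_orbit.
exact: odd_third_orbit.
Qed.

End OddLength.

(** * Dimension three, cycles of odd length *)

Section SingleCycle.

Variables (m : nat) (V : finType) (f : 'I_1 -> V -> V) (h : V -> 'Z_m).
Variable tri : nat -> V * V -> nat * nat * nat.
Hypothesis m_ge3 : 3 <= m.
Hypothesis cardV : #|V| = m.
Hypothesis f_orb : forall i, single_orbit (f i).
Hypothesis f_graded : graded f h.
Hypothesis tri_perm : forall t y, perm3 (tri t y).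
Notation g := (f ord0).

Lemma single_cycle_decomposable :
  single_orbit (layers (fun t y => tri_step g (tri t y).1.1 y) m) ->
  single_orbit (layers (fun t y => tri_step g (tri t y).1.2 y) m) ->
  single_orbit (layers (fun t y => tri_step g (tri t y).2 y) m) ->
  ham_decomposable (@odd_step m V _ f).
Proof.
move=> orb1 orb2 orb3.
apply: (@odd_decomposable m V 0 f h tri (fun _ _ => None)) => //.
  by rewrite cardV coprimePn //; lia.
by move=> i t; rewrite ord1.
Qed.

End SingleCycle.

Section ThreeOdd.

Variables (m : nat) (V : finType) (f : 'I_1 -> V -> V) (x0 : V).
Variable h : V -> 'Z_m.
Hypothesis m_ge3 : 3 <= m.
Hypothesis m_odd : odd m.
Hypothesis cardV : #|V| = m.
Hypothesis f_orb : forall i, single_orbit (f i).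
Hypothesis f_graded : graded f h.
Notation g := (f ord0).

(** Row [x0] is exceptional in the first two layers. A lap is a skew product for
    each of the three colours, with totals [1], [1] and [-2] modulo [m], and
    the third one is prime to [m] as [m] is odd. *)
Definition three_odd_tri (t : nat) (y : V * V) : nat * nat * nat :=
  match t with
  | 0 => if y.2 == x0 then (2, 1, 0) else (2, 0, 1)
  | 1 => if y.2 == x0 then (1, 2, 0) else (0, 2, 1)
  | _ => (1, 0, 2)
  end.

Lemma three_odd_decomposable : ham_decomposable (@odd_step m V _ f).
Proof.
have orbg := f_orb ord0.
have split_m : m = (m - 2) + 2 by lia.
have sum1 : \sum_w (w == x0) = 1 by rewrite (sum_indicator (pred1 x0)) card1.
apply: (single_cycle_decomposable m_ge3 cardV f_orb f_graded (tri := three_odd_tri)).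
- by move=> [|[|t]] y //=; case: ifP.
- pose phi w := m - 2 + (g w == x0).
  have phi_cop : coprime (\sum_w phi w) #|V|.
    rewrite big_split sum_nat_const /= mulnC /coprime gcdnC gcdnMDl gcdnC.
    rewrite -(reindex_inj (single_orbit_inj orbg) (P := predT) (F := fun w => w == x0 : nat)).
    by rewrite sum1 gcd1n.
  apply: eq_single_orbit (single_orbit_skew orbg orbg phi_cop) => -[v w].
  rewrite [X in layers _ X]split_m.
  rewrite (@layers_tail _ _ (fun y => (g y.1, y.2))); last by move=> [|[|t]].
  have -> : layers (fun t y => tri_step g (three_odd_tri t y).1.1 y) 2 (v, w) =
            (iter (g w == x0) g v, g w).
    by rewrite /layers /=; case: (w == x0) => /=; case: (g w == x0).
  by rewrite iter_fst -iterD.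
- apply: eq_single_orbit (single_orbit_skew orbg orbg (phi := fun w => w == x0) _) => [[v w]|].
    rewrite [X in layers _ X]split_m.
    rewrite (@layers_tail _ _ id); last by move=> [|[|t]].
    have -> y : iter (m - 2) id y = y by elim: (m - 2).
    by rewrite /layers /=; case: (w == x0) => /=; case: (w == x0).
  by rewrite sum1 coprime1n.
pose phi w := 2 * (w != x0).
have cop2 : coprime 2 m by rewrite coprime2n.
have phi_cop : coprime (\sum_w phi w) #|V|.
  rewrite -big_distrr /= sum_indicator.
  rewrite (eq_card (B := predC1 x0)) // cardC1 cardV coprimeMl cop2.
  by rewrite coprimePn; lia.
have cop_m2 : coprime (m - 2) #|V|.
  by rewrite cardV /coprime {2}split_m gcdnDl -/(coprime _ _) coprimen2; lia.
apply: eq_single_orbit (single_orbit_skew orbg (single_orbit_expn orbg cop_m2) phi_cop) => -[v w].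
rewrite [X in layers _ X]split_m.
rewrite (@layers_tail _ _ (fun y => (y.1, g y.2))); last by move=> [|[|t]].
by rewrite /layers /= /phi; case E: (w == x0) => /=; rewrite E iter_snd.
Qed.

End ThreeOdd.

(** * Maps of a discrete torus *)

(** Two arcs of different directions with the same head start at two of the
    three points [(v, w)], [(g v, w)], [(v, g w)], up to the choice of [v] and
    [w], so a condition on the directions at these three points is enough. *)
Lemma tri_step_inj (V : finType) (g : V -> V) (d : V * V -> nat) :
  single_orbit g -> (forall y, d y <= 2) ->
  (forall v w, ~~ ((d (g v, w) == 0) && (d (v, w) == 1))) ->
  (forall v w, ~~ ((d (v, g w) == 0) && (d (v, w) == 2))) ->
  (forall v w, ~~ ((d (v, g w) == 1) && (d (g v, w) == 2))) ->
  injective (fun y => tri_step g (d y) y).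
Proof.
move=> orbg d_le2 no01 no02 no12 [v w] [v' w'].
have g_inj := single_orbit_inj orbg.
have cases y : [\/ d y = 0, d y = 1 | d y = 2].
  by have := d_le2 y; case: (d y) => [|[|[|?]]] // _; [constructor 1|constructor 2|constructor 3].
have no a b : ~~ (a && b) -> a -> b -> False by case: a; case: b.
case: (cases (v, w)) => d1; case: (cases (v', w')) => d2; rewrite d1 d2 /=.
- by [].
- by case=> Ev Ew; subst; case: (no _ _ (no01 v' w')); rewrite ?d1 ?d2.
- by case=> Ev Ew; subst; case: (no _ _ (no02 v' w')); rewrite ?d1 ?d2.
- by case=> Ev Ew; subst; case: (no _ _ (no01 v w')); rewrite ?d1 ?d2.
- by case=> /g_inj -> ->.
- by case=> Ev Ew; subst; case: (no _ _ (no12 v w')); rewrite ?d1 ?d2.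
- by case=> Ev Ew; subst; case: (no _ _ (no02 v' w)); rewrite ?d1 ?d2.
- by case=> Ev Ew; subst; case: (no _ _ (no12 v' w)); rewrite ?d1 ?d2.
by case=> -> /g_inj ->.
Qed.

Lemma layers_inj (Y : Type) (L : nat -> Y -> Y) n :
  (forall t, injective (L t)) -> injective (layers L n).
Proof. by move=> L_inj; elim: n => //= n IHn x y /L_inj /IHn. Qed.

Definition inc (N i : nat) : nat := if i.+1 == N then 0 else i.+1.

Definition dir_compat (p q : nat * nat * nat) (a b : nat) : bool :=
  [&& ~~ ((p.1.1 == a) && (q.1.1 == b)), ~~ ((p.1.2 == a) && (q.1.2 == b))
    & ~~ ((p.2 == a) && (q.2 == b))].

(** The local condition of [tri_step_inj] for the three colours at once. *)
Definition regular_tri (N : nat) (T : nat -> nat -> nat * nat * nat) : Prop :=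
  forall i j, i < N -> j < N ->
  [/\ perm3 (T i j), dir_compat (T (inc N i) j) (T i j) 0 1,
      dir_compat (T i (inc N j)) (T i j) 0 2
    & dir_compat (T i (inc N j)) (T (inc N i) j) 1 2].

(** The equivalence relations of which each class is closed under [F] on the
    [N] by [N] box. Orbits of a permutation are classes of such a relation; the
    detour through relations makes every arc usable in both directions. *)
Definition linking (N : nat) (F : nat * nat -> nat * nat)
    (E : nat * nat -> nat * nat -> Prop) : Prop :=
  [/\ forall x, E x x, forall x y, E x y -> E y x,
      forall x y z, E x y -> E y z -> E x z
    & forall i j, i < N -> j < N -> E (i, j) (F (i, j))].

Definition connected_box (N : nat) (F : nat * nat -> nat * nat) : Prop :=
  forall E, linking N F E -> forall i j, i < N -> j < N -> E (i, j) (0, 0).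

Section Box.

Variables (V : finType) (g : V -> V) (x0 : V).
Hypothesis orbg : single_orbit g.
Notation pt := (orbit_pt g x0).
Notation pos := (orbit_pos g x0).
Notation N := #|V|.

Lemma inc_lt i : i < N -> inc N i < N.
Proof. by rewrite /inc; case: eqP; lia. Qed.

Lemma pt_inc i : pt (inc N i) = g (pt i).
Proof.
rewrite /inc; case: eqP => // E.
by rewrite -[g _]/(pt i.+1) E -[N]add0n pt_period.
Qed.

Lemma pos_inc v : pos (g v) = inc N (pos v).
Proof.
rewrite -{1}(posK x0 orbg v) -pt_inc ptK //; apply: inc_lt.
exact: (pos_lt x0 orbg).
Qed.

Definition lift_tri (T : nat -> nat -> nat * nat * nat) (y : V * V) :=
  T (pos y.1) (pos y.2).

Arguments lift_tri : simpl never.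

Lemma lift_tri_pt T i j : i < N -> j < N -> lift_tri T (pt i, pt j) = T i j.
Proof. by move=> lti ltj; rewrite /lift_tri /= !ptK. Qed.

Lemma perm3_le2 p : perm3 p -> [/\ p.1.1 <= 2, p.1.2 <= 2 & p.2 <= 2].
Proof. by rewrite /perm3 !inE; do 5?case/orP; move/eqP=> ->. Qed.

Lemma lift_tri_perm T y : regular_tri N T -> perm3 (lift_tri T y).
Proof. by move=> regT; case: (regT _ _ (pos_lt x0 orbg y.1) (pos_lt x0 orbg y.2)). Qed.

Lemma lift_tri_inj T : regular_tri N T ->
  [/\ injective (fun y => tri_step g (lift_tri T y).1.1 y),
      injective (fun y => tri_step g (lift_tri T y).1.2 y)
    & injective (fun y => tri_step g (lift_tri T y).2 y)].
Proof.
move=> regT; have le2 y := perm3_le2 (lift_tri_perm y regT).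
have reg v w := regT _ _ (pos_lt x0 orbg v) (pos_lt x0 orbg w).
split; apply: tri_step_inj => // [y|v w|v w|v w];
  try (by case: (le2 y)); rewrite /lift_tri /= ?pos_inc;
  case: (reg v w) => _; rewrite /dir_compat;
  by move=> /and3P[A1 A2 A3] /and3P[B1 B2 B3] /and3P[C1 C2 C3].
Qed.

Lemma connected_box_single_orbit (F : V * V -> V * V) FN :
  injective F -> (forall i j, i < N -> j < N ->
    F (pt i, pt j) = (pt (FN (i, j)).1, pt (FN (i, j)).2)) ->
  connected_box N FN -> single_orbit F.
Proof.
move=> F_inj F_pt conn; apply: (single_orbitI (x0 := (pt 0, pt 0)) F_inj) => -[v w].
rewrite -(posK x0 orbg v) -(posK x0 orbg w).
pose E (x y : nat * nat) : Prop := fconnect F (pt x.1, pt x.2) (pt y.1, pt y.2).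
apply: (conn E); [split|exact: (pos_lt x0 orbg)|exact: (pos_lt x0 orbg)].
- by move=> x; apply: connect0.
- by move=> x y; rewrite /E fconnect_sym.
- by move=> x y z; apply: connect_trans.
by move=> i j lti ltj; rewrite /E -F_pt //; apply: fconnect1.
Qed.

End Box.

Definition stepN (N n : nat) (x : nat * nat) : nat * nat :=
  match n with
  | 0 => x
  | 1 => (inc N x.1, x.2)
  | _ => (x.1, inc N x.2)
  end.

Lemma tri_step_pt (V : finType) (g : V -> V) (x0 : V) n x : single_orbit g ->
  tri_step g n (orbit_pt g x0 x.1, orbit_pt g x0 x.2) =
  (orbit_pt g x0 (stepN #|V| n x).1, orbit_pt g x0 (stepN #|V| n x).2).
Proof. by move=> orbg; case: n => [|[|n]]; rewrite //= pt_inc. Qed.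

(** * Dimension three, cycles of even length *)

(* Innermost conditions first, splitting only on those that are undecided. *)
Ltac ifs := repeat match goal with
  |- context [if ?b then _ else _] =>
    lazymatch b with
    | context [if _ then _ else _] => fail
    | _ => first [ rewrite (_ : b = true); [|lia]
                 | rewrite (_ : b = false); [|lia]
                 | case: (boolP b) => ? ]
    end
  end.

Lemma link_run (T : Type) (E : T -> T -> Prop) (p : nat -> T) a b :
  (forall x, E x x) -> (forall x y, E x y -> E y x) ->
  (forall x y z, E x y -> E y z -> E x z) ->
  (forall j, a <= j < b -> E (p j) (p j.+1)) ->
  forall j, a <= j <= b -> E (p j) (p a).
Proof.
move=> Er Es Et Ep; elim=> [|j IHj] lej; first by rewrite (_ : a = 0) //; lia.
have [->|ne] := eqVneq a j.+1; first exact: Er.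
apply: (Et _ _ _ (Es _ _ (Ep j _)) (IHj _)); lia.
Qed.

(** The layer 0 for [m = N] even, at least 6. It differs from a translation
    along the last column, the antidiagonal [v + w = N - 2] and a bounded number
    of rows near row 0. *)
Definition three_even_gadget (N v w : nat) : nat * nat * nat :=
  if w == 0 then
    if v == 0 then (0, 2, 1) else if v == N - 3 then (2, 1, 0) else (0, 1, 2)
  else if w == 1 then
    if v == N - 3 then (1, 2, 0) else if v == N - 2 then (1, 0, 2)
    else if v == N - 1 then (2, 0, 1) else (0, 1, 2)
  else if w <= N - 4 then
    if v + w == N - 2 then (0, 2, 1) else if v == N - 1 then (2, 1, 0)
    else (0, 1, 2)
  else if w == N - 3 then
    if v == 0 then (1, 0, 2) else if v == 1 then (2, 0, 1)
    else if v == N - 1 then (1, 2, 0) else (0, 1, 2)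
  else if w == N - 2 then
    if v == 1 then (2, 1, 0) else if v == N - 2 then (0, 2, 1) else (0, 1, 2)
  else
    if v == 0 then (0, 1, 2) else if v == 1 then (1, 2, 0)
    else if v <= N - 4 then (1, 0, 2) else if v == N - 3 then (2, 0, 1)
    else (0, 1, 2).

Lemma three_even_regular N : 6 <= N -> regular_tri N (three_even_gadget N).
Proof.
move=> N_ge6 i j lti ltj; split.
- by rewrite /three_even_gadget; do !case: ifP => _.
- rewrite /inc; case: eqP => ?;
    rewrite /three_even_gadget; do !case: ifP => ? //; exfalso; lia.
- rewrite /inc; case: eqP => ?;
    rewrite /three_even_gadget; do !case: ifP => ? //; exfalso; lia.
rewrite /inc; do 2!case: eqP => ?;
  rewrite /three_even_gadget; do !case: ifP => ? //; exfalso; lia.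
Qed.

Lemma link_step N F E i j :
  linking N F E -> i < N -> j < N -> E (i, j) (F (i, j)).
Proof. by case=> _ _ _; apply. Qed.

Lemma link_eq (E : nat * nat -> nat * nat -> Prop) x a b c d :
  E x (a, b) -> a = c -> b = d -> E x (c, d).
Proof. by move=> ? <- <-. Qed.

Definition dec2 (N i : nat) : nat := if i < 2 then i + N - 2 else i - 2.

(** One lap of each of the three colours: layer 0 follows the triples [T], and
    the other [N - 1] layers only add a translation. *)
Section ThreeMaps.

Variables (N : nat) (T : nat -> nat -> nat * nat * nat).

Definition three_first (x : nat * nat) : nat * nat :=
  stepN N 2 (stepN N (T x.1 x.2).1.1 x).

Definition three_second (x : nat * nat) : nat * nat :=
  let y := stepN N (T x.1 x.2).1.2 x in (dec2 N y.1, y.2).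

Definition three_third (x : nat * nat) : nat * nat :=
  let y := stepN N (T x.1 x.2).2 x in (inc N y.1, dec2 N y.2).

End ThreeMaps.

Section ThreeEvenTracks.

Variable N : nat.
Hypothesis N_ge6 : 6 <= N.
Hypothesis N_even : ~~ odd N.

(* Reads off from the gadget that two explicit points are joined by an arc. *)
Ltac next := match goal with
  link : linking N _ ?E |- ?E (?i, ?j) (?i', ?j') =>
    move: (@link_step _ _ _ i j link ltac:(lia) ltac:(lia));
    rewrite /three_first /three_second /three_third /three_even_gadget /=;
    ifs; rewrite /= /inc /dec2 /=; ifs; move/link_eq; apply; lia
  end.

(** Columns 2 to [N - 4] are runs followed by the bottom of the next column, and
    the remaining columns are joined one after the other, the last one in two
    runs of even and of odd heights. *)
Lemma three_first_connected : connected_box N (three_first N (three_even_gadget N)).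
Proof.
move=> E link; have [Er Es Et _] := link.
have via x y z : E x y -> E x z -> E y z by move=> /Es /Et; apply.
have chain v a b : (forall j, a <= j < b -> E (v, j) (v, j.+1)) ->
    forall j, a <= j <= b -> E (v, j) (v, a).
  exact: link_run Er Es Et.
have col0 j : j < N -> E (0, j) (0, 0).
  move=> ltj; have [lej|gtj] := leqP j (N - 3).
    by apply: (chain 0 0 (N - 3)); [move=> i lti; next|lia].
  have last : E (0, N - 1) (0, 0) by next.
  have [->|ne] := eqVneq j (N - 1); first by [].
  by apply: (Et _ _ _ _ last); rewrite (_ : j = N - 2); [next|lia].
have col1 : E (1, 0) (0, 0).
  apply: (via (1, N - 2)); first by next.
  by apply: (via (0, N - 3)); [next|apply: (col0 _); lia].
have col1all j : j < N -> E (1, j) (0, 0).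
  have low i : i <= N - 3 -> E (1, i) (0, 0).
    move=> lei; apply: (Et _ _ _ _ col1).
    by apply: (chain 1 0 (N - 3)); [move=> i' lti'; next|lia].
  move=> ltj; have [lej|gtj] := leqP j (N - 3); first exact: low.
  have [->|ne] := eqVneq j (N - 1).
    by apply: (via (1, N - 3)); [next|apply: (low _)].
  by rewrite (_ : j = N - 2); [apply: (Et _ _ _ _ col1); next|lia].
(* columns 2 .. N - 4 are full runs *)
have col v j : 2 <= v <= N - 4 -> j < N -> E (v, j) (v, 0).
  by move=> lev ltj; apply: (chain v 0 N.-1); [move=> i lti; next|lia].
have base v : 1 <= v <= N - 3 -> E (v, 0) (0, 0).
  elim: v => [|v IHv] lev //; have [->|ne] := eqVneq v 0; first exact: col1.
  have [->|ne1] := eqVneq v 1.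
    by apply: (via (1, N - 1)); [next|apply: (col1all _); lia].
  apply: (via (v, N - 1)); first by next.
  by apply: (Et _ _ _ (col v _ _ _) (IHv _)); lia.
have col3 j : 2 <= j < N -> E (N - 3, j) (0, 0).
  move=> ltj; apply: (Et _ (N - 3, 2)).
    by apply: (chain (N - 3) 2 N.-1); [move=> i lti; next|lia].
  by apply: (via (N - 3, 0)); [next|apply: (base _); lia].
have col31 : E (N - 3, 1) (0, 0).
  by apply: (via (N - 3, N - 1)); [next|apply: (col3 _); lia].
have col2 j : 2 <= j < N -> E (N - 2, j) (0, 0).
  move=> ltj; apply: (Et _ (N - 2, 2)).
    by apply: (chain (N - 2) 2 N.-1); [move=> i lti; next|lia].
  by apply: (via (N - 3, 1)); [next|apply: col31].
have col20 : E (N - 2, 0) (0, 0).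
  by apply: (via (N - 2, N - 1)); [next|apply: (col2 _); lia].
have col21 : E (N - 2, 1) (0, 0).
  by apply: (via (N - 2, 0)); [next|apply: col20].
(* the last column is run through first at even heights, then at odd ones *)
have evens i : 1 <= i < N./2 -> E (N - 1, i.*2) (0, 0).
  move=> lti; apply: (Et _ (N - 1, 1.*2)).
    apply: (link_run (b := N./2.-1) (p := fun i => (N - 1, i.*2)) Er Es Et); last lia.
    by move=> j ltj; next.
  by apply: (via (N - 2, 1)); [next|apply: col21].
have last : E (N - 1, N - 1) (0, 0).
  apply: (via (N - 1, N - 2)); first by next.
  by have := evens N./2.-1; rewrite (_ : (N./2.-1).*2 = N - 2); [apply; lia|lia].
have last0 : E (N - 1, 0) (0, 0).
  by apply: (via (N - 1, N - 1)); [next|].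
have odds i : i < N./2.-1 -> E (N - 1, i.*2.+1) (0, 0).
  move=> lti; apply: (Et _ (N - 1, 0.*2.+1)).
    apply: (link_run (b := N./2 - 2) (p := fun i => (N - 1, i.*2.+1)) Er Es Et); last lia.
    by move=> j ltj; next.
  by apply: (via (N - 1, 0)); [next|].
move=> i j lti ltj.
have [lei|gti] := leqP i (N - 4).
  have [->|i0] := eqVneq i 0; first exact: col0.
  have [->|i1] := eqVneq i 1; first exact: col1all.
  by apply: (Et _ _ _ (col i j _ _) (base i _)); lia.
have [->|i3] := eqVneq i (N - 3).
  have [lej|gtj] := leqP 2 j; first by apply: (col3 _); lia.
  have [->|j0] := eqVneq j 0; first by apply: (base _); lia.
  by rewrite (_ : j = 1) //; lia.
have [->|i2] := eqVneq i (N - 2).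
  have [lej|gtj] := leqP 2 j; first by apply: (col2 _); lia.
  have [->|j0] := eqVneq j 0; first by [].
  by rewrite (_ : j = 1) //; lia.
rewrite (_ : i = N - 1); last by lia.
have [->|jN] := eqVneq j (N - 1); first by [].
have [->|j0] := eqVneq j 0; first by [].
have Ej := odd_double_half j; case: (boolP (odd j)) Ej => jodd /= <-.
  by apply: (odds _); lia.
by apply: (evens _); lia.
Qed.

(** The second colour runs along each row to the left and leaves it at one
    point for the next row, except that the last row is crossed in two runs
    through the even and the odd columns. *)
Lemma three_second_connected : connected_box N (three_second N (three_even_gadget N)).
Proof.
move=> E link; have [Er Es Et _] := link.
have via x y z : E x y -> E x z -> E y z by move=> /Es /Et; apply.
(* [chain] follows a run to the left and relates it to its end, column [a] *)
have chain w a b : (forall v, a <= v < b -> E (v.+1, w) (v, w)) ->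
    forall v, a <= v <= b -> E (v, w) (a, w).
  move=> H; apply: (link_run (p := fun v => (v, w)) Er Es Et) => v lev.
  exact: Es (H v lev).
have row0 v : v < N -> E (v, 0) (0, 0).
  by move=> ltv; apply: (chain 0 0 N.-1); [move=> i lti; next|lia].
have hub1 : E (N - 2, 1) (0, 0) by apply: (via (0, 0)); [next|].
have hub1' : E (N - 4, 1) (0, 0) by apply: (via (N - 2, 1)); [next|].
have low1 v : v <= N - 4 -> E (v, 1) (0, 1).
  by move=> ltv; apply: (chain 1 0 (N - 4)); [move=> i lti; next|lia].
have hub01 : E (0, 1) (0, 0) by apply: (via (N - 4, 1)); [apply: low1|].
have hub11 : E (N - 1, 1) (0, 0) by apply: (via (0, 1)); [next|].
have hub31 : E (N - 3, 1) (0, 0) by apply: (via (N - 1, 1)); [next|].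
have row1 v : v < N -> E (v, 1) (0, 0).
  move=> ltv; have [lev|gtv] := leqP v (N - 4).
    by apply: (Et _ _ _ (low1 _ lev) hub01).
  have [->|v1] := eqVneq v (N - 1); first by [].
  have [->|v2] := eqVneq v (N - 2); first by [].
  by rewrite (_ : v = N - 3) //; lia.
have rows w v : 1 <= w <= N - 4 -> v < N -> E (v, w) (0, 0).
  elim: w v => // w IHw v lew ltv.
  have [->|w0] := eqVneq w 0; first exact: row1.
  have start : E (N - 4 - w, w.+1) (0, 0).
    have [->|w1] := eqVneq w 1.
      by apply: (via (N - 3, 1)); [next|].
    apply: (via (N - 2 - w, w)); first by next.
    by apply: IHw; lia.
  have low i : i <= N - 4 - w -> E (i, w.+1) (0, w.+1).
    by move=> lei; apply: (chain _ 0 (N - 4 - w)); [move=> j ltj; next|lia].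
  have hub : E (0, w.+1) (0, 0) by apply: (via (N - 4 - w, w.+1)); [apply: (low _)|].
  have [lev|gtv] := leqP v (N - 4 - w); first exact: (Et _ _ _ (low _ lev) hub).
  apply: (Et _ (N - 3 - w, w.+1)).
    by apply: (chain _ (N - 3 - w) N.-1); [move=> j ltj; next|lia].
  apply: (via (N - 1, w.+1)).
    by apply: (chain _ (N - 3 - w) N.-1); [move=> j ltj; next|lia].
  by apply: (via (0, w.+1)); [next|].
have row3 v : v < N -> E (v, N - 3) (0, 0).
  have hub0 : E (0, N - 3) (0, 0).
    by apply: (via (2, N - 4)); [next|apply: (rows _); lia].
  have hub2 : E (N - 2, N - 3) (0, 0) by apply: (via (0, N - 3)); [next|].
  have mid i : 1 <= i <= N - 2 -> E (i, N - 3) (1, N - 3).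
    by move=> lei; apply: (chain _ 1 (N - 2)); [move=> j ltj; next|lia].
  have h1 : E (1, N - 3) (0, 0) by apply: (via (N - 2, N - 3)); [apply: (mid _); lia|].
  move=> ltv; have [->|v0] := eqVneq v 0; first by [].
  have [->|v1] := eqVneq v (N - 1); first by apply: (via (1, N - 3)); [next|].
  by apply: (Et _ _ _ (mid _ _) h1); lia.
have row2 v : v < N -> E (v, N - 2) (0, 0).
  have low i : i <= N - 3 -> E (i, N - 2) (0, N - 2).
    by move=> lei; apply: (chain _ 0 (N - 3)); [move=> j ltj; next|lia].
  have h3 : E (N - 3, N - 2) (0, 0).
    by apply: (via (N - 1, N - 3)); [next|apply: (row3 _); lia].
  have h0 : E (0, N - 2) (0, 0) by apply: (via (N - 3, N - 2)); [apply: (low _)|].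
  have h1 : E (N - 1, N - 2) (0, 0) by apply: (via (0, N - 2)); [next|].
  move=> ltv; have [lev|gtv] := leqP v (N - 3); first exact: (Et _ _ _ (low _ lev) h0).
  have [->|v1] := eqVneq v (N - 1); first by [].
  by rewrite (_ : v = N - 2); [apply: (via (N - 1, N - 2)); [next|]|lia].
(* the last row is left through the even columns, then through the odd ones *)
have evens i : i <= N./2 - 2 -> E (i.*2, N - 1) (0, 0).
  have to0 j : j <= N./2 - 2 -> E (j.*2, N - 1) (0.*2, N - 1).
    move=> lej; apply: (link_run (b := N./2 - 2) (p := fun i => (i.*2, N - 1)) Er Es Et); last lia.
    by move=> i' lti'; apply: Es; next.
  have h4 : E ((N./2 - 2).*2, N - 1) (0, 0).
    rewrite (_ : (N./2 - 2).*2 = N - 4); last by lia.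
    by apply: (via (N - 2, N - 2)); [next|apply: (row2 _); lia].
  by move=> lei; apply: (Et _ _ _ (to0 _ lei)); apply: (via _ _ _ (to0 _ (leqnn _)) h4).
have h1 : E (N - 1, N - 1) (0, 0).
  by apply: (via (0.*2, N - 1)); [next|apply: (evens _)].
have h2 : E (N - 2, N - 1) (0, 0) by apply: (via (N - 1, N - 1)); [next|].
have h3 : E (N - 3, N - 1) (0, 0) by apply: (via (N - 2, N - 1)); [next|].
have odds i : i <= N./2 - 2 -> E (i.*2.+1, N - 1) (0, 0).
  have to1 j : j <= N./2 - 2 -> E (j.*2.+1, N - 1) (0.*2.+1, N - 1).
    move=> lej; apply: (link_run (b := N./2 - 2) (p := fun i => (i.*2.+1, N - 1)) Er Es Et); last lia.
    by move=> i' lti'; apply: Es; next.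
  have h4 : E ((N./2 - 2).*2.+1, N - 1) (0, 0).
    by rewrite (_ : (N./2 - 2).*2.+1 = N - 3) //; lia.
  by move=> lei; apply: (Et _ _ _ (to1 _ lei)); apply: (via _ _ _ (to1 _ (leqnn _)) h4).
move=> i j lti ltj.
have [->|j0] := eqVneq j 0; first exact: row0.
have [lej|gtj] := leqP j (N - 4); first by apply: (rows _); lia.
have [->|j3] := eqVneq j (N - 3); first exact: row3.
have [->|j2] := eqVneq j (N - 2); first exact: row2.
rewrite (_ : j = N - 1); last by lia.
have [->|i1] := eqVneq i (N - 1); first by [].
have [->|i2] := eqVneq i (N - 2); first by [].
have Ei := odd_double_half i; case: (boolP (odd i)) Ei => iodd /= <-.
  by apply: odds; lia.
by apply: evens; lia.
Qed.

(** The third colour runs along the diagonals [v + w = u] modulo [N]. Each of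
    them is left at exactly one point, for the diagonal [u - 1]. *)
Lemma three_third_connected : connected_box N (three_third N (three_even_gadget N)).
Proof.
move=> E link; have [Er Es Et _] := link.
have via x y z : E x y -> E x z -> E y z by move=> /Es /Et; apply.
(* the track u consists of the points with v + w = u modulo N *)
pose q u v := (v, if v <= u then u - v else u + N - v).
have chain u a b : (forall v, a <= v < b -> E (q u v) (q u v.+1)) ->
    forall v, a <= v <= b -> E (q u v) (q u a).
  exact: link_run Er Es Et.
have track_generic u v : 1 <= u <= N - 5 -> v < N -> E (q u v) (q u 0).
  move=> leu ltv; apply: (chain u 0 N.-1); [move=> i lti|lia].
  by rewrite /q; ifs; next.
have track0 v : v < N -> E (q 0 v) (q 0 0).
  move=> ltv; have [->|v0] := eqVneq v 0; first exact: Er.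
  have h2 : E (q 0 2) (q 0 0) by apply: Es; rewrite /q; ifs; next.
  have high i : 2 <= i <= N.-1 -> E (q 0 i) (q 0 0).
    move=> lei; apply: (Et _ _ _ (chain 0 2 N.-1 _ _ lei) h2) => j ltj.
    by rewrite /q; ifs; next.
  have [->|v1] := eqVneq v 1; last by apply: (high _); lia.
  by apply: (via (q 0 N.-1)); [rewrite /q; ifs; next|apply: (high _); lia].
have track4 v : v < N -> E (q (N - 4) v) (q (N - 4) 0).
  have low i : 0 <= i <= N - 3 -> E (q (N - 4) i) (q (N - 4) 0).
    by apply: chain => j ltj; rewrite /q; ifs; next.
  move=> ltv; have [lev|gtv] := leqP v (N - 3); first by apply: (low _); lia.
  have [->|v1] := eqVneq v (N - 2); first by rewrite /q; ifs; next.
  rewrite (_ : v = N - 1); last by lia.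
  by apply: (via (q (N - 4) (N - 3))); [rewrite /q; ifs; next|apply: (low _); lia].
have track3 v : v < N -> E (q (N - 3) v) (q (N - 3) 0).
  have low i : 0 <= i <= N - 3 -> E (q (N - 3) i) (q (N - 3) 0).
    by apply: chain => j ltj; rewrite /q; ifs; next.
  have h1 : E (q (N - 3) (N - 1)) (q (N - 3) 0) by rewrite /q; ifs; next.
  move=> ltv; have [lev|gtv] := leqP v (N - 3); first by apply: (low _); lia.
  have [->|v1] := eqVneq v (N - 1); first by [].
  by apply: (Et _ _ _ _ h1); rewrite (_ : v = N - 2); [rewrite /q; ifs; next|lia].
have track1 v : v < N -> E (q (N - 1) v) (q (N - 1) 0).
  have high i : 2 <= i <= N - 1 -> E (q (N - 1) i) (q (N - 1) 2).
    by apply: chain => j ltj; rewrite /q; ifs; next.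
  have h1 : E (q (N - 1) (N - 1)) (q (N - 1) 0) by rewrite /q; ifs; next.
  have h2 : E (q (N - 1) 2) (q (N - 1) 0).
    by apply: (via (q (N - 1) (N - 1))); [apply: (high _); lia|].
  move=> ltv; have [->|v0] := eqVneq v 0; first exact: Er.
  have [->|v1] := eqVneq v 1; first by apply: Es; rewrite /q; ifs; next.
  by apply: (Et _ _ _ (high _ _) h2); lia.
have track2 v : v < N -> E (q (N - 2) v) (q (N - 2) 0).
  have evens i : 1 <= i <= N./2.-1 -> E (q (N - 2) i.*2) (q (N - 2) 1.*2).
    apply: (link_run (p := fun i => q (N - 2) i.*2) Er Es Et) => j ltj.
    by rewrite /q; ifs; next.
  have odds i : 0 <= i <= N./2 - 2 -> E (q (N - 2) i.*2.+1) (q (N - 2) 0.*2.+1).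
    apply: (link_run (p := fun i => q (N - 2) i.*2.+1) Er Es Et) => j ltj.
    by rewrite /q; ifs; next.
  have h1 : E (q (N - 2) (N - 1)) (q (N - 2) 0) by rewrite /q; ifs; next.
  have h2 : E (q (N - 2) (N - 2)) (q (N - 2) 0).
    by apply: (Et _ _ _ _ h1); rewrite /q; ifs; next.
  have he : E (q (N - 2) 1.*2) (q (N - 2) 0).
    apply: (via (q (N - 2) (N./2.-1).*2)); first by apply: (evens _); lia.
    by rewrite (_ : (N./2.-1).*2 = N - 2) //; lia.
  have ho : E (q (N - 2) 0.*2.+1) (q (N - 2) 0).
    by apply: Es; rewrite /q; ifs; next.
  move=> ltv; have [->|v0] := eqVneq v 0; first exact: Er.
  have [->|v1] := eqVneq v (N - 1); first by [].
  have Ev := odd_double_half v; case: (boolP (odd v)) Ev => vodd /= <-.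
    by apply: (Et _ _ _ (odds _ _) ho); lia.
  by apply: (Et _ _ _ (evens _ _) he); lia.
have track u v : u < N -> v < N -> E (q u v) (q u 0).
  move=> ltu ltv; have [->|u0] := eqVneq u 0; first exact: track0.
  have [->|u4] := eqVneq u (N - 4); first exact: track4.
  have [->|u3] := eqVneq u (N - 3); first exact: track3.
  have [->|u2] := eqVneq u (N - 2); first exact: track2.
  have [->|u1] := eqVneq u (N - 1); first exact: track1.
  by apply: track_generic; lia.
have tracks u : u < N -> E (q u 0) (q 0 0).
  elim: u => [|u IHu] ltu; first exact: Er.
  have step a b : E (q u.+1 a) (q u b) -> a < N -> b < N -> E (q u.+1 0) (q 0 0).
    move=> st lta ltb; apply: (via _ _ _ (track _ _ _ _)); [exact: ltu|exact: lta|].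
    apply: (Et _ _ _ st); apply: (Et _ _ _ (track _ _ _ _) (IHu _)); lia.
  have [leu|gtu] := leqP u.+1 (N - 4).
    by apply: (step (N - 1) 0); [rewrite /q; ifs; next|lia|lia].
  have [leu1|gtu1] := leqP u.+1 (N - 2).
    by apply: (step (N - 3) (N - 2)); [rewrite /q; ifs; next|lia|lia].
  by apply: (step 1 2); [rewrite /q; ifs; next|lia|lia].
move=> i j lti ltj.
have -> : (0, 0) = q 0 0 by [].
pose u := if i + j < N then i + j else i + j - N.
have ltu : u < N by rewrite /u; case: ifP; lia.
have -> : (i, j) = q u i by rewrite /q /u; congr (_, _); ifs; lia.
by apply: (Et _ _ _ (track _ _ _ _) (tracks _ _)).
Qed.

End ThreeEvenTracks.

Lemma iter_dec2 (V : finType) (g : V -> V) (x0 : V) i :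
  single_orbit g -> 2 <= #|V| ->
  iter (#|V| - 2) g (orbit_pt g x0 i) = orbit_pt g x0 (dec2 #|V| i).
Proof.
move=> orbg N_ge2; rewrite /orbit_pt -iterD /dec2; case: ltnP => lti.
  by congr (iter _ _ _); lia.
rewrite -[RHS](pt_period x0 orbg); congr (iter _ _ _); lia.
Qed.

Lemma tri_step_const_inj (V : finType) (g : V -> V) n :
  injective g -> injective (tri_step g n).
Proof.
move=> g_inj [v w] [v' w']; case: n => [|[|n]] //=.
  by case=> /g_inj -> ->.
by case=> -> /g_inj ->.
Qed.

Section ThreeEven.

Variables (m : nat) (V : finType) (f : 'I_1 -> V -> V) (x0 : V).
Variable h : V -> 'Z_m.
Hypothesis m_ge3 : 3 <= m.
Hypothesis cardV : #|V| = m.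
Hypothesis f_orb : forall i, single_orbit (f i).
Hypothesis f_graded : graded f h.
Variable T : nat -> nat -> nat * nat * nat.
Hypothesis regT : regular_tri m T.
Hypothesis conn1 : connected_box m (three_first m T).
Hypothesis conn2 : connected_box m (three_second m T).
Hypothesis conn3 : connected_box m (three_third m T).
Notation g := (f ord0).

Definition three_even_tri (t : nat) (y : V * V) : nat * nat * nat :=
  match t with
  | 0 => lift_tri g x0 T y
  | 1 => (2, 0, 1)
  | _ => (0, 1, 2)
  end.

Lemma three_gadget_decomposable : ham_decomposable (@odd_step m V _ f).
Proof.
have orbg := f_orb ord0; have g_inj := single_orbit_inj orbg.
have regN : regular_tri #|V| T by rewrite cardV.
have [inj1 inj2 inj3] := lift_tri_inj x0 orbg regN.
have split_m : m = (#|V| - 2) + 2 by rewrite cardV; lia.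
have dec i : iter (#|V| - 2) g (orbit_pt g x0 i) = orbit_pt g x0 (dec2 #|V| i).
  by apply: iter_dec2 => //; rewrite cardV; lia.
apply: (single_cycle_decomposable m_ge3 cardV f_orb f_graded (tri := three_even_tri)).
- by move=> [|[|t]] y //=; apply: lift_tri_perm.
- apply: (connected_box_single_orbit (x0 := x0) orbg (FN := three_first #|V| T)).
  + apply: layers_inj => -[|[|t]] //; exact: (tri_step_const_inj (n := 2)).
  + move=> i j lti ltj; rewrite split_m (@layers_tail _ _ id); last by move=> [|[|t]].
    have -> y : iter (#|V| - 2) id y = y by elim: (#|V| - 2).
    by rewrite /layers /= lift_tri_pt // (tri_step_pt x0 _ (i, j)) //= pt_inc.
  by rewrite cardV.
- apply: (connected_box_single_orbit (x0 := x0) orbg (FN := three_second #|V| T)).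
  + apply: layers_inj => -[|[|t]] //; exact: (tri_step_const_inj (n := 1)).
  + move=> i j lti ltj; rewrite split_m.
    rewrite (@layers_tail _ _ (fun y => (g y.1, y.2))); last by move=> [|[|t]].
    rewrite /layers /= lift_tri_pt // (tri_step_pt x0 _ (i, j)) //.
    by rewrite iter_fst dec.
  by rewrite cardV.
apply: (connected_box_single_orbit (x0 := x0) orbg (FN := three_third #|V| T)).
- apply: layers_inj => -[|[|t]] //; first exact: (tri_step_const_inj (n := 1)).
  exact: (tri_step_const_inj (n := 2)).
- move=> i j lti ltj; rewrite split_m.
  rewrite (@layers_tail _ _ (fun y => (y.1, g y.2))); last by move=> [|[|t]].
  rewrite /layers /= lift_tri_pt // (tri_step_pt x0 _ (i, j)) //.
  by rewrite iter_snd /= dec pt_inc.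
by rewrite cardV.
Qed.

End ThreeEven.

Lemma three_even_decomposable m (V : finType) (f : 'I_1 -> V -> V)
    (h : V -> 'Z_m) : 6 <= m -> ~~ odd m -> #|V| = m ->
  (forall i, single_orbit (f i)) -> graded f h ->
  ham_decomposable (@odd_step m V _ f).
Proof.
move=> m_ge6 m_even cardV f_orb f_graded.
have [x0 _] : exists x0, x0 \in V by apply/card_gt0P; rewrite cardV; lia.
apply: (three_gadget_decomposable x0 _ cardV f_orb f_graded
  (three_even_regular m_ge6)); first by lia.
- exact: three_first_connected.
- exact: three_second_connected.
exact: three_third_connected.
Qed.

(** The general pattern needs six rows; for [m = 4] this layer 0 takes its
    place, the other layers being the same. *)
Definition three_four_gadget (v w : nat) : nat * nat * nat :=
  nth (0, 1, 2) (nth [::]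
    [:: [:: (0, 1, 2); (1, 2, 0); (1, 2, 0); (2, 0, 1)];
        [:: (1, 0, 2); (1, 2, 0); (2, 1, 0); (1, 2, 0)];
        [:: (2, 0, 1); (0, 1, 2); (1, 2, 0); (1, 2, 0)];
        [:: (1, 2, 0); (2, 0, 1); (0, 2, 1); (0, 1, 2)]] w) v.

Lemma connected_box_iter N F :
  (forall i j, i < N -> j < N -> (F (i, j)).1 < N /\ (F (i, j)).2 < N) ->
  (forall i j, i < N -> j < N -> exists n, iter n F (i, j) = (0, 0)) ->
  connected_box N F.
Proof.
move=> F_lt reach E link i j lti ltj; have [Er _ Et _] := link.
have [n] := reach i j lti ltj.
elim: n i j lti ltj => [|n IHn] i j lti ltj; first by move=> /= ->.
rewrite iterSr; have [] := F_lt i j lti ltj.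
have := link_step link lti ltj; case: (F (i, j)) => i' j' Eij lti' ltj' /IHn H.
by apply: (Et _ _ _ Eij); apply: H.
Qed.

Lemma three_four_decomposable (V : finType) (f : 'I_1 -> V -> V)
    (h : V -> 'Z_4) : #|V| = 4 ->
  (forall i, single_orbit (f i)) -> graded f h ->
  ham_decomposable (@odd_step 4 V _ f).
Proof.
move=> cardV f_orb f_graded.
have [x0 _] : exists x0, x0 \in V by apply/card_gt0P; rewrite cardV.
have by_computation F :
    all (fun i => all (fun j => [&& (F (i, j)).1 < 4, (F (i, j)).2 < 4 &
      has (fun n => iter n F (i, j) == (0, 0)) (iota 0 16)]) (iota 0 4)) (iota 0 4) ->
    connected_box 4 F.
  move=> check; have ok i j : i < 4 -> j < 4 -> [&& (F (i, j)).1 < 4, (F (i, j)).2 < 4 &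
      has (fun n => iter n F (i, j) == (0, 0)) (iota 0 16)].
    move=> lti ltj; have := allP check i; rewrite mem_iota => /(_ lti) /allP /(_ j).
    by rewrite mem_iota => /(_ ltj).
  apply: connected_box_iter => i j lti ltj; case/and3P: (ok i j lti ltj) => // _ _.
  by case/hasP => n _ /eqP <-; exists n.
apply: (three_gadget_decomposable x0 _ cardV f_orb f_graded (T := three_four_gadget)) => //.
- by move=> [|[|[|[|i]]]] [|[|[|[|j]]]].
- by apply: by_computation; vm_compute.
- by apply: by_computation; vm_compute.
by apply: by_computation; vm_compute.
Qed.

(** * Cycles of even length, several pairs: the layers *)

(** The number of special rows is even, hence not prime to the length of the
    cycles, and the skew product that serves for the third colour when [m] is
    odd falls apart. Instead, layer 0 departs from a translation along the last
    row, the last column and the antidiagonal [v + w = N - 3]. *)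
Definition big_gadget (N v w : nat) : nat * nat * nat :=
  if w == N - 1 then
    if v <= N - 3 then (1, 0, 2) else if v == N - 2 then (1, 2, 0) else (2, 0, 1)
  else if v == N - 1 then
    if w <= N - 3 then (2, 1, 0) else (1, 0, 2)
  else if v + w == N - 3 then (0, 2, 1)
  else if w == N - 2 then
    if v == 0 then (2, 1, 0) else if v == N - 2 then (0, 2, 1) else (0, 1, 2)
  else (0, 1, 2).

(** The rows below [s] are the special ones; layers 1, 2 and 3 depend on the
    diagonal, the row and the column respectively. *)
Definition even_layer (N s t v w : nat) : nat * nat * nat :=
  match t with
  | 0 => big_gadget N v w
  | 1 => if (v + w == N - 2) || (v + w == 2 * N - 2) then (0, 1, 2) else (0, 2, 1)
  | 2 => if (w < s) || (w == N - 1) then (0, 1, 2) else (1, 0, 2)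
  | 3 => if v == N - 1 then (2, 1, 0) else (0, 1, 2)
  | _ => (0, 1, 2)
  end.

Lemma even_layer_regular N s t : 6 <= N -> regular_tri N (even_layer N s t).
Proof.
move=> N_ge6 i j lti ltj; split.
- case: t => [|[|[|[|t]]]] //=; rewrite /big_gadget; by do !case: ifP => _.
- rewrite /inc; case: eqP => ?; case: t => [|[|[|[|t]]]] //=;
    rewrite /big_gadget; do !case: ifP => ? //; exfalso; lia.
- rewrite /inc; case: eqP => ?; case: t => [|[|[|[|t]]]] //=;
    rewrite /big_gadget; do !case: ifP => ? //; exfalso; lia.
rewrite /inc; do 2!case: eqP => ?; case: t => [|[|[|[|t]]]] //=;
  rewrite /big_gadget; do !case: ifP => ? //; exfalso; lia.
Qed.

Lemma rowwise_inj (V : Type) (R : V -> V -> V) :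
  (forall w, injective (R w)) -> injective (fun y : V * V => (R y.2 y.1, y.2)).
Proof. by move=> R_inj [v w] [v' w'] [] /[swap] /= -> /R_inj ->. Qed.

Lemma single_orbit_neq (T : finType) (F : T -> T) x :
  single_orbit F -> 1 < #|T| -> F x != x.
Proof.
move=> orbF gt1; apply: contraTneq gt1 => Fx; rewrite -leqNgt.
apply/card_le1P => y _ z; rewrite inE; apply/esym/eqP.
have fixed u : u = x.
  rewrite -(iter_findex (orbF x u)); elim: (findex F x u) => //= n ->.
  exact: Fx.
by rewrite (fixed y) (fixed z).
Qed.

(** * Cycles of even length, several pairs: the first colour *)

Section EvenLength.

Variables (m : nat) (V : finType) (k : nat) (f : 'I_k.+1 -> V -> V) (x0 : V).
Variable h : V -> 'Z_m.
Hypothesis m_ge4 : 4 <= m.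
Hypothesis m_even : ~~ odd m.
Hypothesis k_gt0 : 0 < k.
Hypothesis cardV : #|V| = m ^ k.+1.
Hypothesis f_orb : forall i, single_orbit (f i).
Hypothesis f_graded : graded f h.
Notation g := (f ord0).
Notation pos := (orbit_pos g x0).
Notation pt := (orbit_pt g x0).
Notation N := #|V|.
Notation special := (special_row m f x0).
Notation s := (num_special m k).

Definition even_tri (t : nat) : V * V -> nat * nat * nat :=
  lift_tri g x0 (even_layer N s t).

Let top := pt (N - 1).

Let m_ge3 : 3 <= m. Proof. by lia. Qed.

Let N_ge : 4 * m <= N.
Proof. exact: four_mul_le_card k_gt0 cardV m_ge4. Qed.

Let s_le : s <= N - 2.
Proof. exact: num_special_lt k_gt0 cardV m_ge4. Qed.

Let orbg : single_orbit g := f_orb ord0.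

Let pos_topE v : (pos v == N - 1) = (v == top).
Proof. by apply: (eq_pos x0 orbg); lia. Qed.

Lemma even_tri_perm t y : perm3 (even_tri t y).
Proof. by apply: lift_tri_perm => //; apply: even_layer_regular; lia. Qed.

Lemma even_tri_special t y i : special t y.2 = Some i -> (even_tri t y).1.1 = 0.
Proof.
rewrite /even_tri /lift_tri; case: t => [|[|[|t]]] //=.
- by rewrite /special_row /sp_layer; case: (_ && (_ %% _ == _)); rewrite andbF.
- by case: ifP.
- by rewrite /special_row; case: (pos y.2 < _).
by rewrite special_layer.
Qed.

Definition row_map w : V -> V :=
  if special 1 w is Some i then f i else
  if special 2 w is Some i then f i else
  if w == top then id else g.

Lemma row_map_orbit j : j <= N - 2 -> single_orbit (row_map (pt j)).
Proof.
move=> lej; rewrite /row_map; case: (special 1 _) => [i|]; first exact: f_orb.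
case: (special 2 _) => [i|]; first exact: f_orb.
rewrite -pos_topE ptK //; last by lia.
by rewrite ifN_eq //; lia.
Qed.

Lemma row_map_last j : N - 2 <= j < N -> row_map (pt j) = if j == N - 1 then id else g.
Proof.
move=> lej; rewrite /row_map /special_row -pos_topE !ptK //; try lia.
by rewrite ltnNge (_ : s <= j) //; lia.
Qed.

Notation first := (layers (first_layer f even_tri special) m).

Lemma first_eval i j : i < N -> j < N ->
  first (pt i, pt j) =
  let y := stepN N (big_gadget N i j).1.1 (i, j) in
  let v := row_map (pt y.2) (pt y.1) in
  (v, if v == top then pt (inc N y.2) else pt y.2).
Proof.
move=> lti ltj; rewrite [X in layers _ X](_ : m = (m - 4) + 4); last by lia.
rewrite (@layers_tail _ _ id); last first.
  by move=> [|[|[|[|t]]]] // _ [v w]; rewrite /first_layer special_layer.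
have -> y : iter (m - 4) id y = y by elim: (m - 4).
rewrite /layers {4}/first_layer special_layer //=.
rewrite !ptK // (tri_step_pt x0 _ (i, j)) //.
set y := stepN _ _ _; move: (pt y.1) => v; set w := pt y.2.
have L1 : first_layer f even_tri special 1 (v, w) =
    (if special 1 w is Some i then f i v else v, w).
  rewrite /first_layer /=; case: (special 1 w) => //.
  by rewrite /even_tri /lift_tri /=; case: ifP.
have L2 v' : first_layer f even_tri special 2 (v', w) =
    (if special 2 w is Some i then f i v' else
     if (pos w < s) || (w == top) then v' else g v', w).
  rewrite /first_layer /=; case: (special 2 w) => //.
  by rewrite /even_tri /lift_tri /= pos_topE; case: ifP.
have L3 v' : first_layer f even_tri special 3 (v', w) =
    (v', if v' == top then g w else w).
  rewrite /first_layer special_layer //= /even_tri /lift_tri /= pos_topE.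
  by case: ifP.
rewrite L1 L2 L3 pt_inc // -/w.
suff -> : row_map w v = if special 2 w is Some i0 then f i0 (if special 1 w is Some i1 then f i1 v else v)
  else if (pos w < s) || (w == top) then (if special 1 w is Some i1 then f i1 v else v)
       else g (if special 1 w is Some i1 then f i1 v else v) by [].
rewrite /row_map /special_row /sp_layer.
case: (boolP (pos w < s)) => lt_s //=; last by case: (w == top).
by case: (_ && (_ %% _ == _)).
Qed.

Lemma first_inj : injective first.
Proof.
have inj1 t := let: And3 H _ _ := lift_tri_inj x0 orbg
  (even_layer_regular s t (ltac:(lia) : 6 <= N)) in H.
apply: layers_inj => t; rewrite /first_layer.
have [->|t1] := eqVneq t 1.
  pose R w := if special 1 w is Some i then f i else id.
  apply: (@eq_inj _ _ (fun y => (R y.2 y.1, y.2))).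
    apply: rowwise_inj => w; rewrite /R; case: (special 1 w) => [i|] //.
    exact: single_orbit_inj.
  move=> [v w]; rewrite /R /=; case: (special 1 w) => //.
  by rewrite /even_tri /lift_tri /=; case: ifP.
have [->|t2] := eqVneq t 2.
  pose R w := if special 2 w is Some i then f i else
              if (pos w < s) || (pos w == N - 1) then id else g.
  apply: (@eq_inj _ _ (fun y => (R y.2 y.1, y.2))).
    apply: rowwise_inj => w; rewrite /R; case: (special 2 w) => [i|].
      exact: single_orbit_inj.
    by case: ifP => _; [exact: inj_id|exact: single_orbit_inj].
  move=> [v w]; rewrite /R /=; case: (special 2 w) => //.
  by rewrite /even_tri /lift_tri /=; case: ifP.
apply: (@eq_inj _ _ _ _ (inj1 t)) => y.
by rewrite special_layer.
Qed.

(** A row [w <= N - 3] is run through along its cycle up to the last column,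
    where the colour climbs; on the last column it therefore advances by two
    rows at a time, once through the even and once through the odd heights, and
    the last two rows connect these two runs with each other. *)
Lemma even_first_orbit : single_orbit first.
Proof.
have N_gt1 : 1 < N by lia.
have conn i j : i < N -> j < N -> fconnect first (pt i, pt j) (first (pt i, pt j)).
  by move=> lti ltj; apply: fconnect1.
have via x y z : fconnect first x y -> fconnect first x z -> fconnect first y z.
  by rewrite (fconnect_sym first_inj x y); apply: connect_trans.
have eq_top i : i < N -> (pt i == top) = (i == N - 1).
  by move=> lti; rewrite -pos_topE ptK.
(* a row below N - 2 is run through up to the last column, which lifts to the
   next row *)
have row v j : j <= N - 3 -> v != top ->
    fconnect first (v, pt j) (top, pt j.+1).
  move=> lej neq_v.
  have orbR : single_orbit (row_map (pt j)) by apply: row_map_orbit; lia.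
  have stepE u : u != top -> first (u, pt j) =
      (row_map (pt j) u, if row_map (pt j) u == top then pt j.+1 else pt j).
    rewrite -pos_topE => nu; have ltu := pos_lt x0 orbg u.
    have := first_eval ltu (_ : j < N); rewrite (posK x0 orbg) => -> //; last by lia.
    have -> : (big_gadget N (pos u) j).1.1 = 0.
      by rewrite /big_gadget (negPf nu); ifs.
    by rewrite /= (posK x0 orbg) /inc (_ : (j.+1 == N) = false) //; lia.
  pose Rel u u' := u != top -> u' != top /\ fconnect first (u, pt j) (u', pt j).
  have [|x y z Rxy Ryz nx||u nu neq_u|u /eqP Eu Rvu] := @run_until _ (row_map (pt j))
      (fun u => row_map (pt j) u == top) Rel v.
  - by move=> u nu; split.
  - have [ny cxy] := Rxy nx; have [nz cyz] := Ryz ny.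
    by split=> //; apply: connect_trans cxy cyz.
  - exists (findex (row_map (pt j)) (row_map (pt j) v) top).
    by rewrite -iterS iterSr iter_findex //; apply: orbR.
  - split=> //; have := fconnect1 first (u, pt j).
    by rewrite stepE // (negPf nu).
  have [neq_u cvu] := Rvu neq_v; apply: connect_trans cvu _.
  by have := fconnect1 first (u, pt j); rewrite stepE // Eu eqxx.
have lift j : j <= N - 4 -> fconnect first (top, pt j) (top, pt j.+2).
  move=> lej; have [lt1 ltj lej1] : [/\ N - 1 < N, j < N & j.+1 <= N - 3] by split; lia.
  have := conn (N - 1) j lt1 ltj; rewrite first_eval //.
  have -> : (big_gadget N (N - 1) j).1.1 = 2 by rewrite /big_gadget; ifs.
  rewrite /= -/top /inc (_ : (j.+1 == N) = false); last by lia.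
  have neq : row_map (pt j.+1) top != top.
    by apply: single_orbit_neq => //; apply: row_map_orbit; lia.
  by rewrite (negPf neq) => C; apply: connect_trans C (row _ j.+1 lej1 neq).
have even_col j : j.*2 <= N - 2 -> fconnect first (top, pt j.*2) (top, pt 0).
  elim: j => [|j IHj] lej; first exact: connect0.
  by apply: (via (top, pt j.*2)); [apply: lift|apply: IHj]; lia.
have odd_col j : j.*2.+1 <= N - 3 -> fconnect first (top, pt j.*2.+1) (top, pt 1).
  elim: j => [|j IHj] lej; first exact: connect0.
  by apply: (via (top, pt j.*2.+1)); [apply: lift|apply: IHj]; lia.
have [lt0 lt1 lt2 lt3] : [/\ 0 < N, N - 1 < N, N - 2 < N & N - 3 < N] by split; lia.
have inc1 : inc N (N - 1) = 0 by rewrite /inc; ifs.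
have inc2 : inc N (N - 2) = N - 1 by rewrite /inc; ifs; lia.
have inc3 : inc N (N - 3) = N - 2 by rewrite /inc; ifs; lia.
have incS i : i < N - 1 -> inc N i = i.+1 by move=> lti; rewrite /inc; ifs.
have map_last : row_map (pt (N - 1)) = id by rewrite row_map_last ?eqxx //; lia.
have map_last2 : row_map (pt (N - 2)) = g.
  by rewrite row_map_last ?ifN_eq //; lia.
have g_pt i : g (pt i) = pt (inc N i) by rewrite pt_inc.
have neq0 : (0 == N - 1) = false by lia.
(* row N - 1 is crossed by the default arcs *)
have last_row i : i <= N - 2 -> fconnect first (pt i, pt (N - 1)) (top, pt 0).
  have [d] := ubnP (N - 1 - i); elim: d i => // d IHd i led lei.
  have lti : i < N by lia.
  have := conn i (N - 1) lti lt1; rewrite first_eval //.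
  have -> : (big_gadget N i (N - 1)).1.1 = 1 by rewrite /big_gadget; ifs.
  have lt_i1 : i < N - 1 by lia.
  rewrite /= map_last incS // eq_top; last by lia.
  case: eqP => [->|/eqP ne]; first by rewrite inc1.
  by move=> C; apply: connect_trans C (IHd _ _ _); lia.
have last_top : fconnect first (top, pt (N - 1)) (top, pt 1).
  have := conn (N - 1) (N - 1) lt1 lt1; rewrite first_eval //.
  have -> : (big_gadget N (N - 1) (N - 1)).1.1 = 2 by rewrite /big_gadget; ifs.
  have neq : row_map (pt 0) top != top.
    by apply: single_orbit_neq => //; apply: row_map_orbit.
  by rewrite /= inc1 (negPf neq) => C; apply: connect_trans C (row _ 0 _ neq).
have penult0 : fconnect first (pt 0, pt (N - 2)) (top, pt 0).
  have := conn 0 (N - 2) lt0 lt2; rewrite first_eval //.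
  have -> : (big_gadget N 0 (N - 2)).1.1 = 2 by rewrite /big_gadget; ifs.
  rewrite /= inc2 map_last -[x0 in x0 == top]/(pt 0) eq_top // neq0.
  by move=> C; apply: connect_trans C (last_row 0 _).
have penult i : 1 <= i <= N - 2 -> fconnect first (pt i, pt (N - 2)) (top, pt 1).
  have [d] := ubnP (N - 1 - i); elim: d i => // d IHd i led lei.
  have lti : i < N by lia.
  have := conn i (N - 2) lti lt2; rewrite first_eval //.
  have -> : (big_gadget N i (N - 2)).1.1 = 0 by rewrite /big_gadget; ifs.
  have lt_i1 : i < N - 1 by lia.
  rewrite /= map_last2 g_pt incS // eq_top; last by lia.
  case: eqP => [->|/eqP ne] C.
    by rewrite inc2 in C; apply: connect_trans C last_top.
  by apply: connect_trans C (IHd _ _ _); lia.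
have penult_top : fconnect first (top, pt (N - 2)) (top, pt 1).
  have := conn (N - 1) (N - 2) lt1 lt2; rewrite first_eval //.
  have -> : (big_gadget N (N - 1) (N - 2)).1.1 = 1 by rewrite /big_gadget; ifs.
  have lt_0 : 0 < N - 1 by lia.
  rewrite /= inc1 map_last2 g_pt incS // eq_top; last by lia.
  have -> : (1 == N - 1) = false by lia.
  by move=> C; apply: connect_trans C (penult 1 _); lia.
have antepenult : fconnect first (top, pt (N - 3)) (top, pt 0).
  have := conn (N - 1) (N - 3) lt1 lt3; rewrite first_eval //.
  have -> : (big_gadget N (N - 1) (N - 3)).1.1 = 2 by rewrite /big_gadget; ifs.
  rewrite /= inc3 map_last2 g_pt inc1 eq_top // neq0.
  by move=> C; apply: connect_trans C penult0.
have N_even : ~~ odd N by rewrite cardV oddX.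
have col1 : fconnect first (top, pt 1) (top, pt 0).
  apply: (via (top, pt (N - 3))) antepenult.
  by have := odd_col (N./2 - 2); rewrite (_ : (N./2 - 2).*2.+1 = N - 3); [apply; lia|lia].
have col j : j < N -> fconnect first (top, pt j) (top, pt 0).
  move=> ltj; have [->|j1] := eqVneq j (N - 1).
    exact: connect_trans last_top col1.
  have Ej := odd_double_half j; case: (boolP (odd j)) Ej => jodd /= <-.
    by apply: connect_trans (odd_col _ _) col1; lia.
  by apply: even_col; lia.
apply: (single_orbitI (x0 := (top, pt 0)) first_inj) => -[v w].
rewrite -(posK x0 orbg w); have := pos_lt x0 orbg w; move: (pos w) => j ltj.
have [->|neq_v] := eqVneq v top; first exact: col.
have [lej|gtj] := leqP j (N - 3).
  by apply: connect_trans (row _ _ lej neq_v) (col _ _); lia.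
rewrite -(posK x0 orbg v) eq_top ?pos_lt // in neq_v *.
have := pos_lt x0 orbg v; move: (pos v) neq_v => i ne lti.
have [->|j1] := eqVneq j (N - 1); first by apply: last_row; lia.
rewrite (_ : j = N - 2); last by lia.
have [->|i0] := eqVneq i 0; first exact: penult0.
by apply: connect_trans (penult i _) col1; lia.
Qed.

End EvenLength.

(** * Return maps with a few rewired points *)

(** The situation of a return map: [x] is followed by [sigma x], except that a
    few values of [sigma] are permuted by [kap]. *)
Section Rewiring.

Variables (V : finType) (sigma kap : V -> V) (R : V -> V -> Prop).
Hypothesis Rrefl : forall x, R x x.
Hypothesis Rtrans : forall x y z, R x y -> R y z -> R x z.
Hypothesis Rkap : forall x, R x (kap (sigma x)).

Lemma rewired_run x n : 0 < n ->
  (forall i, 0 < i < n -> kap (iter i sigma x) = iter i sigma x) ->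
  R x (kap (iter n sigma x)).
Proof.
case: n => // n _ fixed; rewrite iterS; apply: Rtrans (Rkap _).
have: n <= n by []; elim: {1 3}n => [|i IHi] lei; first exact: Rrefl.
apply: Rtrans (IHi (ltnW lei)) _.
by rewrite -[X in R _ X]fixed //; apply: Rkap.
Qed.

(** On the cycle of [x] under [sigma] only [x] and [y] are rewired, so the run
    that starts at [x] first meets [y] and is sent to [kap y]. *)
Lemma rewired_pair x y : x != y -> fconnect sigma x y ->
  (forall z, fconnect sigma x z -> z != x -> z != y -> kap z = z) ->
  R x (kap y).
Proof.
move=> neq_xy xy fixed; rewrite -[y in R _ (kap y)](iter_findex xy).
apply: rewired_run => [|i /andP[i_gt0 lt_i]].
  by rewrite lt0n findex_eq0.
have lt_ord : i < order sigma x by apply: leq_trans lt_i (ltnW (findex_max xy)).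
have Ei := findex_iter lt_ord; apply: fixed (fconnect_iter _ _ _) _ _.
  by apply/eqP => E; rewrite E findex0 in Ei; rewrite -Ei in i_gt0.
by apply/eqP => E; rewrite -Ei E ltnn in lt_i.
Qed.

Lemma rewired_exit (P : pred V) x e : P e -> fconnect sigma (sigma x) e ->
  (forall z, ~~ P z -> kap z = z) -> exists2 e', P e' & R x (kap e').
Proof.
move=> Pe xe fixed.
have [||||u Pu xu] := @run_until _ sigma (fun u => P (sigma u)) R x.
- exact: Rrefl.
- exact: Rtrans.
- exists (findex sigma (sigma x) e); rewrite -iterS iterSr iter_findex //.
- by move=> u nP; rewrite -[sigma u]fixed.
by exists (sigma u) => //; apply: Rtrans xu (Rkap u).
Qed.

End Rewiring.

Section Parity.

Variables (V : finType) (g : V -> V) (x0 : V).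
Hypothesis orbg : single_orbit g.
Notation N := #|V|.
Notation pt := (orbit_pt g x0).
Notation pos := (orbit_pos g x0).
Hypothesis N_even : ~~ odd N.

Lemma pt_periodM i n : pt (i + n * N) = pt i.
Proof. by elim: n => [|n IHn]; rewrite ?addn0 // mulSn addnCA addnC pt_period. Qed.

Lemma pos_pt i : pos (pt i) = i %% N.
Proof.
rewrite {1}(divn_eq i N) addnC pt_periodM ptK // ltn_mod.
by apply/card_gt0P; exists x0.
Qed.

Lemma odd_mod_even i : odd (i %% N) = odd i.
Proof. by rewrite {2}(divn_eq i N) oddD oddM (negPf N_even) andbF. Qed.

Variable q : nat.
Hypothesis cop_q : coprime q N.

(** On a cycle of even length [N], an even step [2 q] with [q] prime to [N] has
    two orbits, the two parity classes. *)
Lemma parity_class i x :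
  fconnect (iter (2 * q) g) (pt i) x = (odd (pos x) == odd i).
Proof.
apply/idP/eqP => [ix|par].
  rewrite -(iter_findex ix) -iterM /orbit_pt -iterD -/(pt _) pos_pt odd_mod_even.
  by rewrite oddD !oddM /= andbF addFb.
have orbq := single_orbit_expn orbg cop_q.
have := iter_findex (orbq (pt i) x); set n := findex _ _ _ => En.
have En' : pt (n * q + i) = x by rewrite -En -iterM /orbit_pt iterD.
have q_odd : odd q.
  move: cop_q; case: (boolP (odd q)) => // q_even.
  have : 2 %| gcdn q N by rewrite dvdn_gcd !dvdn2 q_even N_even.
  by rewrite /coprime => d2 /eqP E; rewrite E in d2.
have n_even : ~~ odd n.
  move: par; rewrite -En' pos_pt odd_mod_even oddD oddM q_odd andbT.
  by case: (odd n); case: (odd i).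
rewrite -En -[n](even_halfK n_even) -iterM -muln2 -mulnA iterM.
exact: fconnect_iter.
Qed.

End Parity.

(** * Cycles of even length, several pairs: the second colour *)

Definition swap_second (N : nat) (x : nat * nat) : nat * nat :=
  if (x.1 == N - 1) && (x.2 == N - 1) then (N - 2, 0) else
  if (x.1 == N - 2) && (x.2 == 0) then (N - 1, 0) else
  if (x.1 == N - 1) && (x.2 == 0) then (0, N - 1) else
  if (x.1 == 0) && (x.2 == N - 1) then (N - 1, N - 1) else x.

(** Checked on positions, with all conditions linear in [N], [i] and [j]. *)
Lemma even_head_second N s i j : 6 <= N -> i < N -> j < N ->
  let y := stepN N (big_gadget N i j).1.2 (i, j) in
  stepN N (even_layer N s 1 y.1 y.2).1.2 y =
  swap_second N (if j == N - 1 then i else inc N i, inc N j).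
Proof.
move=> N_ge6 lti ltj y.
have : [\/ (big_gadget N i j).1.2 = 0, (big_gadget N i j).1.2 = 1 | (big_gadget N i j).1.2 = 2].
  by rewrite /big_gadget; do !case: ifP => _; first [constructor 1; reflexivity|constructor 2; reflexivity|constructor 3; reflexivity].
rewrite /y {y}; case=> Eb; rewrite Eb /swap_second /=; move: Eb; rewrite /inc;
  ifs; rewrite /big_gadget; ifs; move=> // _; rewrite /= /inc; ifs; congr (_, _); lia.
Qed.

Section EvenSecond.

Variables (m : nat) (V : finType) (g : V -> V) (x0 : V) (s q : nat).
Hypothesis m_ge4 : 4 <= m.
Hypothesis m_even : ~~ odd m.
Hypothesis orbg : single_orbit g.
Notation N := #|V|.
Notation pt := (orbit_pt g x0).
Notation pos := (orbit_pos g x0).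
Hypothesis N_even : ~~ odd N.
Hypothesis N_ge : 4 * m <= N.
Hypothesis s_le : s <= N - 2.
Hypothesis s_eq : s = 2 * q.
Hypothesis cop_q : coprime q N.

Let tri t := lift_tri g x0 (even_layer N s t).
Let second := layers (fun t y => tri_step g (tri t y).1.2 y).
Let top := pt (N - 1).

Let g_inj : injective g := single_orbit_inj orbg.

Let eq_pt i j : i < N -> j < N -> (pt i == pt j) = (i == j).
Proof. exact: eq_pt. Qed.

Lemma second_inj n : injective (second n).
Proof.
apply: layers_inj => t.
by case: (lift_tri_inj x0 orbg (even_layer_regular s t (ltac:(lia) : 6 <= N))).
Qed.

(** The cyclic permutation of four points by which the first two layers differ
    from the plain motion of [second_head], one step in each direction except
    along the last row. *)
Definition second_swap (y : V * V) : V * V :=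
  if y == (top, top) then (pt (N - 2), pt 0) else
  if y == (pt (N - 2), pt 0) then (top, pt 0) else
  if y == (top, pt 0) then (pt 0, top) else
  if y == (pt 0, top) then (top, top) else y.

Lemma second_head v w :
  second 2 (v, w) = second_swap (if w == top then v else g v, g w).
Proof.
rewrite -(posK x0 orbg v) -(posK x0 orbg w).
have := pos_lt x0 orbg v; have := pos_lt x0 orbg w.
move: (pos v) (pos w) => i j ltj lti.
rewrite /second /layers /tri lift_tri_pt // (tri_step_pt x0 _ (i, j)) //.
rewrite /second_swap /top eq_pt //; last by lia.
have -> : (if j == N - 1 then pt i else g (pt i)) = pt (if j == N - 1 then i else inc N i).
  by case: ifP; rewrite ?pt_inc.
rewrite -pt_inc // !xpair_eqE.
set i' := if j == N - 1 then i else _; set j' := inc N j.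
have lti' : i' < N by rewrite /i' /inc; ifs; lia.
have ltj' : j' < N by rewrite /j' /inc; ifs; lia.
rewrite !eq_pt //; try lia.
have lty (y := stepN N (big_gadget N i j).1.2 (i, j)) : y.1 < N /\ y.2 < N.
  by rewrite /y; case: (big_gadget N i j).1.2 => [|[|?]] /=; split; rewrite // inc_lt.
rewrite [even_layer N s 0 i j]/=; move: lty; set y := stepN _ _ _ => -[lty1 lty2].
rewrite lift_tri_pt // (tri_step_pt x0 _ y) //.
have N_ge6 : 6 <= N by lia.
rewrite (even_head_second s N_ge6 lti ltj) -/i' -/j' /swap_second /=.
by do !case: ifP.
Qed.

Definition second_tail (y : V * V) : V * V :=
  (iter (m - 3 + (pos y.2 < s) + (y.2 == top)) g y.1, y.2).

Let pos_topE v : (pos v == N - 1) = (v == top).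
Proof. by apply: (eq_pos x0 orbg); lia. Qed.

Lemma second_split : second m =1 second_tail \o second 2.
Proof.
move=> y; rewrite [X in second X](_ : m = (m - 4) + 4); last by lia.
rewrite /second (@layers_tail _ _ (fun y => (g y.1, y.2))); last first.
  by move=> [|[|[|[|t]]]].
have -> L : layers L 4 y = L 3 (L 2 (layers L 2 y)) :> V * V by [].
rewrite -/second -[RHS]/(second_tail (second 2 y)); case: (second 2 y) => v w.
have L2 : tri_step g (tri 2 (v, w)).1.2 (v, w) =
    (iter ((pos w < s) || (w == top)) g v, w).
  by rewrite /tri /lift_tri /= pos_topE; case: ifP.
have L3 z : tri_step g (tri 3 z).1.2 z = (g z.1, z.2).
  by rewrite /tri /lift_tri /=; case: ifP.
rewrite L2 L3 iter_fst /second_tail /= -iterS -iterD; congr (iter _ g v, w).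
have : ~~ ((pos w < s) && (w == top)) by rewrite -pos_topE; lia.
by case: (pos w < s); case: (w == top) => //= _; lia.
Qed.

Lemma second_tail_inj : injective second_tail.
Proof.
apply: (@rowwise_inj _ (fun w => iter (m - 3 + (pos w < s) + (w == top)) g)) => w.
by elim: (_ + _) => // n IHn x y /g_inj /IHn.
Qed.

(** The lap, read from layer 2 on: up to [second_swap] it is a skew product of
    translations, see [second_walkE]. *)
Definition second_walk : V * V -> V * V := second 2 \o second_tail.

Lemma second_walk_inj : injective second_walk.
Proof. exact: inj_comp (@second_inj 2) second_tail_inj. Qed.

Lemma second_walkE v w :
  second_walk (v, w) = second_swap (iter (m - 2 + (pos w < s)) g v, g w).
Proof.
rewrite /second_walk /= second_head; congr (second_swap (_, _)).
have : ~~ ((pos w < s) && (w == top)) by rewrite -pos_topE; lia.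
by case: (w == top); case: (pos w < s) => //= _; rewrite -?iterS; congr (iter _ g v); lia.
Qed.

Lemma second_swap_id v w : w != pt 0 -> w != top -> second_swap (v, w) = (v, w).
Proof.
by move=> /negPf w0 /negPf w1; rewrite /second_swap !xpair_eqE w0 w1 !andbF.
Qed.

(** The four points exchanged by [second_swap] lie in two adjacent rows. Seen
    from row 0, their effect is a cyclic permutation of four values of the
    return map [x |-> x + s], where the shift [s] is the number of special
    rows. *)
Definition second_kappa (z : V) : V :=
  if z == pt (N - 2) then top else if z == top then pt (m - 2) else
  if z == pt (m - 2) then pt (m - 3) else
  if z == pt (m - 3) then pt (N - 2) else z.

Let E := fconnect second_walk.
Let Etrans x y z : E x y -> E y z -> E x z. Proof. exact: connect_trans. Qed.
Let E1 v w : E (v, w) (second_swap (iter (m - 2 + (pos w < s)) g v, g w)).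
Proof. by rewrite -second_walkE; apply: fconnect1. Qed.

Definition second_shift j := j * (m - 2) + minn j s.

Lemma second_rows x j : j <= N - 2 ->
  E (x, pt 0) (iter (second_shift j) g x, pt j).
Proof.
elim: j => [|j IHj] lej; first by rewrite /second_shift min0n; apply: connect0.
apply: Etrans (IHj _) _; first by lia.
have := E1 (iter (second_shift j) g x) (pt j).
rewrite -pt_inc // /inc (_ : (j.+1 == N) = false); last by lia.
rewrite second_swap_id ?eq_pt; try lia.
rewrite ptK -?iterD //; last by lia.
rewrite (_ : _ + second_shift j = second_shift j.+1) //.
by rewrite /second_shift mulSn; case: (ltnP j s) => ltjs; rewrite /minn; do ![case: ifP => ?]; lia.
Qed.

Let small_neq a b : a < b < N -> (pt a == pt b) = false.
Proof. by move=> ?; rewrite eq_pt; lia. Qed.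

Let g_top : g top = pt 0.
Proof. by rewrite -pt_inc // /inc; ifs. Qed.

Let top0 : (top == pt 0) = false.
Proof. by rewrite eq_sym small_neq; lia. Qed.

Lemma second_swap0 u : second_swap (u, pt 0) =
  if u == pt (N - 2) then (top, pt 0) else
  if u == top then (pt 0, top) else (u, pt 0).
Proof.
by rewrite /second_swap !xpair_eqE [pt 0 == top]eq_sym top0 eqxx !andbF !andbT.
Qed.

Lemma second_last_row u : E (u, top) (second_swap (iter (m - 2) g u, pt 0)).
Proof.
have := E1 u top; rewrite g_top /top (ptK x0 orbg); last by lia.
by rewrite (_ : (N - 1 < s) = false) ?addn0 //; lia.
Qed.

Lemma second_return x : E (x, pt 0) (second_kappa (iter s g x), pt 0).
Proof.
have top_shift n : iter n.+1 g top = pt n.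
  by rewrite iterSr g_top -[pt 0]/x0.
apply: Etrans (second_rows x (leqnn _)) _; set y := iter _ g x.
have step := E1 y (pt (N - 2)).
rewrite -pt_inc // /inc (_ : ((N - 2).+1 == N) = false) in step; last by lia.
rewrite (ptK x0 orbg) in step; last by lia.
rewrite (_ : (N - 2 < s) = false) ?addn0 in step; last by lia.
rewrite (_ : (N - 2).+1 = N - 1) -/top in step; last by lia.
have Ez : iter s g x = iter (m - 2) g (iter (m - 2) g y).
  rewrite -!iterD -[in LHS](iter_period orbg (m - 2) x) -iterD.
  congr (iter _ g x); rewrite /second_shift (minn_idPr s_le).
  by rewrite -[in LHS](subnK (ltac:(lia) : 2 <= N)) mulnDr mulnC; lia.
apply: Etrans step _; rewrite Ez; set z := iter (m - 2) g y.
have swap1 u : second_swap (u, top) =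
    if u == top then (pt (N - 2), pt 0) else if u == pt 0 then (top, top)
    else (u, top).
  by rewrite /second_swap !xpair_eqE top0 eqxx !andbF !andbT.
have m_3 : m - 2 = (m - 3).+1 by lia.
have shift_top : iter (m - 2) g top = pt (m - 3) by rewrite m_3 top_shift.
have shift_inj : injective (iter (m - 2) g).
  by elim: (m - 2) => // n IHn a b /g_inj /IHn.
have z_m3 : (iter (m - 2) g z == pt (m - 3)) = (z == top).
  by rewrite -shift_top (inj_eq shift_inj).
have z_m2 : (iter (m - 2) g z == pt (m - 2)) = (z == pt 0).
  by rewrite -[pt (m - 2)]/(iter (m - 2) g (pt 0)) (inj_eq shift_inj).
rewrite swap1 /second_kappa z_m3 z_m2.
have [z_top|z_top] := eqVneq z top.
  have neq2 : (z == pt 0) = false by rewrite z_top.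
  rewrite neq2 z_top shift_top !small_neq ?(rwP eqP) //; try lia.
  exact: connect0.
have [z_0|z_0] := eqVneq z (pt 0).
  rewrite z_0 -[iter (m - 2) g (pt 0)]/(pt (m - 2)) !small_neq; try lia.
  have := second_last_row top; rewrite shift_top second_swap0 !small_neq //; lia.
apply: Etrans (second_last_row z) _; rewrite second_swap0.
case: ifP => _; first exact: connect0.
case: ifP => _; last exact: connect0.
have := second_last_row (pt 0); rewrite -[iter (m - 2) g (pt 0)]/(pt (m - 2)) second_swap0.
by rewrite !small_neq //; lia.
Qed.

Lemma second_kappa_id z : z != pt (N - 2) -> z != top -> z != pt (m - 2) ->
  z != pt (m - 3) -> second_kappa z = z.
Proof. by rewrite /second_kappa; do 4!move/negPf ->. Qed.

Let par_neq z a : a < N -> odd (pos z) != odd a -> z != pt a.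
Proof. by move=> lta; apply: contraNneq => ->; rewrite ptK. Qed.

Let R x y := E (x, pt 0) (y, pt 0).
Let Rtrans x y z : R x y -> R y z -> R x z. Proof. exact: connect_trans. Qed.
Let Rsym x y : R x y -> R y x.
Proof. by rewrite /R /E (fconnect_sym second_walk_inj). Qed.

Let same_parity i x : odd (pos x) = odd i -> fconnect (iter s g) (pt i) x.
Proof. by move=> par; rewrite s_eq (parity_class _ _ N_even cop_q) // par. Qed.

(** The four rewired points cut each parity class into two arcs, and the
    rewiring glues the four arcs into a single cycle. *)
Lemma second_hubs z : z \in [:: pt (N - 2); top; pt (m - 2); pt (m - 3)] ->
  R z (pt (N - 2)).
Proof.
have pair a b c d : a < N -> b < N -> c < N -> d < N -> a != b ->
    odd a = odd b -> odd c != odd a -> odd d != odd a ->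
    (forall z, z != pt a -> z != pt b -> z != pt c -> z != pt d -> second_kappa z = z) ->
    R (pt a) (second_kappa (pt b)).
  move=> lta ltb ltc ltd neq par parc pard fixed.
  apply: (@rewired_pair V (iter s g) second_kappa R) => [x|x y y'|x||| w].
  - exact: connect0.
  - exact: Rtrans.
  - exact: second_return.
  - by rewrite eq_pt.
  - by apply: same_parity; rewrite ptK.
  rewrite s_eq (parity_class _ _ N_even cop_q) // => /eqP parw na nb.
  by apply: fixed na nb _ _; apply: par_neq => //; rewrite parw eq_sym.
have kN2 : second_kappa (pt (N - 2)) = top by rewrite /second_kappa eqxx.
have k_top : second_kappa top = pt (m - 2).
  by rewrite /second_kappa eqxx eq_pt ?ifN //; lia.
have km2 : second_kappa (pt (m - 2)) = pt (m - 3).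
  by rewrite /second_kappa eqxx !small_neq //; lia.
have km3 : second_kappa (pt (m - 3)) = pt (N - 2).
  by rewrite /second_kappa eqxx !small_neq //; lia.
have r1 : R (pt (m - 2)) top.
  rewrite -kN2; apply: (pair _ _ (N - 1) (m - 3)); try lia.
  by move=> u *; apply: second_kappa_id.
have r2 : R top (pt (N - 2)).
  rewrite -km3; apply: (pair _ _ (N - 2) (m - 2)); try lia.
  by move=> u *; apply: second_kappa_id.
have r3 : R (pt (m - 3)) (pt (m - 2)).
  rewrite -k_top; apply: (pair _ _ (N - 2) (m - 2)); try lia.
  by move=> u *; apply: second_kappa_id.
rewrite !inE => /or4P[] /eqP ->; [exact: connect0|by []| |].
- exact: Rtrans r1 r2.
exact: Rtrans r3 (Rtrans r1 r2).
Qed.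

Lemma second_row0 x : R x (pt (N - 2)).
Proof.
pose P z := z \in [:: pt (N - 2); top; pt (m - 2); pt (m - 3)].
have [e Pe xe] : exists2 e, P e & fconnect (iter s g) (iter s g x) e.
  exists (if odd (pos (iter s g x)) then top else pt (N - 2)).
    by rewrite /P; case: ifP; rewrite !inE eqxx ?orbT.
  rewrite -{1}(posK x0 orbg (iter s g x)); apply: same_parity.
  by case: ifP => par; rewrite ptK //; lia.
have [||||e' Pe' xe'] := rewired_exit (sigma := iter s g) (kap := second_kappa) (R := R) _ _ _ Pe xe.
- by move=> y; apply: connect0.
- exact: Rtrans.
- exact: second_return.
- by move=> z; rewrite /P !inE !negb_or => /and4P[]; apply: second_kappa_id.
apply: Rtrans xe' _; apply: second_hubs; move: Pe'; rewrite /P !inE.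
case/or4P => /eqP ->; rewrite /second_kappa; do !case: ifP => _; rewrite eqxx ?orbT //.
Qed.

Lemma second_walk_orbit : single_orbit second_walk.
Proof.
apply: (single_orbitI (x0 := (pt (N - 2), pt 0)) second_walk_inj) => -[v w].
suff [x vx] : exists x, E (v, w) (x, pt 0) by apply: Etrans vx (second_row0 x).
rewrite -(posK x0 orbg w); have := pos_lt x0 orbg w; move: (pos w) => j ltj.
have [->|neq_j] := eqVneq j (N - 1).
  have m2_0 : E (pt 0, top) (pt (m - 2), pt 0).
    have := second_last_row (pt 0); rewrite -[iter (m - 2) g (pt 0)]/(pt (m - 2)).
    by rewrite second_swap0 !small_neq //; lia.
  have := second_last_row v; rewrite second_swap0.
  case: ifP => _; first by exists top.
  case: ifP => _ vx; last by exists (iter (m - 2) g v).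
  by exists (pt (m - 2)); apply: Etrans vx m2_0.
have shift_inj n : injective (iter n g).
  by elim: n => // n IHn a b /g_inj /IHn.
have [gV _ gVK] := injF_bij (shift_inj (second_shift j)).
exists (gV v); rewrite /E (fconnect_sym second_walk_inj).
have := second_rows (gV v) (_ : j <= N - 2); rewrite gVK; apply.
by lia.
Qed.

Lemma even_second_orbit : single_orbit (second m).
Proof.
apply: eq_single_orbit (fun y => esym (second_split y)) _.
exact: single_orbit_conj second_tail_inj second_walk_orbit.
Qed.

End EvenSecond.

(** * Cycles of even length, several pairs: the third colour *)

Definition swap_third (N : nat) (x : nat * nat) : nat * nat :=
  if (x.1 == 1) && (x.2 == N - 1) then (0, N - 1) else
  if (x.1 == 0) && (x.2 == N - 1) then (1, N - 1) else
  if (x.1 == N - 1) && (x.2 == N - 1) then (0, N - 2) else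
  if (x.1 == 0) && (x.2 == N - 2) then (N - 1, 0) else
  if (x.1 == N - 1) && (x.2 == 0) then (N - 1, N - 1) else x.

Lemma even_head_third N s i j : 6 <= N -> i < N -> j < N ->
  let y := stepN N (big_gadget N i j).2 (i, j) in
  stepN N (even_layer N s 1 y.1 y.2).2 y =
  swap_third N (inc N i, if i == N - 1 then j else inc N j).
Proof.
move=> N_ge6 lti ltj y.
have : [\/ (big_gadget N i j).2 = 0, (big_gadget N i j).2 = 1 | (big_gadget N i j).2 = 2].
  by rewrite /big_gadget; do !case: ifP => _; first [constructor 1; reflexivity|constructor 2; reflexivity|constructor 3; reflexivity].
rewrite /y {y}; case=> Eb; rewrite Eb /swap_third /=; move: Eb; rewrite /inc;
  ifs; rewrite /big_gadget; ifs; move=> // _; rewrite /= /inc; ifs; congr (_, _); lia.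
Qed.

Section EvenThird.

Variables (m : nat) (V : finType) (g : V -> V) (x0 : V) (s : nat).
Hypothesis m_ge4 : 4 <= m.
Hypothesis m_even : ~~ odd m.
Hypothesis orbg : single_orbit g.
Notation N := #|V|.
Notation pt := (orbit_pt g x0).
Notation pos := (orbit_pos g x0).
Hypothesis N_four : 4 %| N.
Hypothesis N_ge : 4 * m <= N.

Let tri t := lift_tri g x0 (even_layer N s t).
Let third := layers (fun t y => tri_step g (tri t y).2 y).
Let top := pt (N - 1).

Let g_inj : injective g := single_orbit_inj orbg.

Let iter_inj n : injective (iter n g).
Proof. by elim: n => // n IHn a b /g_inj /IHn. Qed.

Let N_even : ~~ odd N.
Proof. by rewrite -dvdn2; apply: dvdn_trans N_four. Qed.

Let eq_pt i j : i < N -> j < N -> (pt i == pt j) = (i == j).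
Proof. exact: eq_pt. Qed.

Let small_neq a b : a < b < N -> (pt a == pt b) = false.
Proof. by move=> ?; rewrite eq_pt; lia. Qed.

Let small_neqr a b : a < b < N -> (pt b == pt a) = false.
Proof. by move=> ?; rewrite eq_pt; lia. Qed.

Let small_top a : a < N - 1 -> (pt a == top) = false.
Proof. by move=> lta; rewrite small_neq //; lia. Qed.

Lemma third_inj n : injective (third n).
Proof.
apply: layers_inj => t.
by case: (lift_tri_inj x0 orbg (even_layer_regular s t (ltac:(lia) : 6 <= N))).
Qed.

(** The same for the third colour, with five points, and with the last column
    in place of the last row. *)
Definition third_swap (y : V * V) : V * V :=
  if y == (pt 1, top) then (pt 0, top) else
  if y == (pt 0, top) then (pt 1, top) else
  if y == (top, top) then (pt 0, pt (N - 2)) else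
  if y == (pt 0, pt (N - 2)) then (top, pt 0) else
  if y == (top, pt 0) then (top, top) else y.

Lemma third_head v w :
  third 2 (v, w) = third_swap (g v, if v == top then w else g w).
Proof.
rewrite -(posK x0 orbg v) -(posK x0 orbg w).
have := pos_lt x0 orbg v; have := pos_lt x0 orbg w.
move: (pos v) (pos w) => i j ltj lti.
rewrite /third /layers /tri lift_tri_pt // (tri_step_pt x0 _ (i, j)) //.
rewrite /third_swap /top eq_pt //; last by lia.
have -> : (if i == N - 1 then pt j else g (pt j)) = pt (if i == N - 1 then j else inc N j).
  by case: ifP; rewrite ?pt_inc.
rewrite -pt_inc // !xpair_eqE.
set j' := if i == N - 1 then j else _; set i' := inc N i.
have lti' : i' < N by rewrite /i' /inc; ifs; lia.
have ltj' : j' < N by rewrite /j' /inc; ifs; lia.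
rewrite !eq_pt //; try lia.
have lty (y := stepN N (big_gadget N i j).2 (i, j)) : y.1 < N /\ y.2 < N.
  by rewrite /y; case: (big_gadget N i j).2 => [|[|?]] /=; split; rewrite // inc_lt.
rewrite [even_layer N s 0 i j]/=; move: lty; set y := stepN _ _ _ => -[lty1 lty2].
rewrite lift_tri_pt // (tri_step_pt x0 _ y) //.
have N_ge6 : 6 <= N by lia.
rewrite (even_head_third s N_ge6 lti ltj) -/i' -/j' /swap_third /=.
by do !case: ifP.
Qed.

Definition third_tail (y : V * V) : V * V :=
  (y.1, iter (m - 3 + (y.1 != top)) g y.2).

Let pos_topE v : (pos v == N - 1) = (v == top).
Proof. by apply: (eq_pos x0 orbg); lia. Qed.

Lemma third_split : third m =1 third_tail \o third 2.
Proof.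
move=> y; rewrite [X in third X](_ : m = (m - 4) + 4); last by lia.
rewrite /third (@layers_tail _ _ (fun y => (y.1, g y.2))); last first.
  by move=> [|[|[|[|t]]]].
have -> L : layers L 4 y = L 3 (L 2 (layers L 2 y)) :> V * V by [].
rewrite -/third -[RHS]/(third_tail (third 2 y)); case: (third 2 y) => v w.
have L2 z : tri_step g (tri 2 z).2 z = (z.1, g z.2).
  by rewrite /tri /lift_tri /=; case: ifP.
have L3 z : tri_step g (tri 3 z).2 z = (z.1, iter (z.1 != top) g z.2).
  by case: z => a b; rewrite /tri /lift_tri /= pos_topE; case: ifP.
rewrite L2 L3 iter_snd /third_tail /= -iterSr -iterD; congr (v, iter _ g w).
by case: (v == top) => /=; lia.
Qed.

Lemma third_tail_inj : injective third_tail.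
Proof.
move=> [v w] [v' w']; rewrite /third_tail /= => -[<-].
by move/iter_inj ->.
Qed.

Definition third_walk : V * V -> V * V := third 2 \o third_tail.

Lemma third_walk_inj : injective third_walk.
Proof. exact: inj_comp (@third_inj 2) third_tail_inj. Qed.

Lemma third_walkE v w :
  third_walk (v, w) =
  third_swap (g v, iter (if v == top then m - 3 else m - 1) g w).
Proof.
rewrite /third_walk /= third_head; congr (third_swap (_, _)).
by case: (v == top); rewrite /= -?iterS; congr (iter _ g w); lia.
Qed.

Let E := fconnect third_walk.
Let Etrans x y z : E x y -> E y z -> E x z. Proof. exact: connect_trans. Qed.
Let E1 v w :
  E (v, w) (third_swap (g v, iter (if v == top then m - 3 else m - 1) g w)).
Proof. by rewrite -third_walkE; apply: fconnect1. Qed.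

Let iter_pt n i : iter n g (pt i) = pt (n + i).
Proof. by rewrite /orbit_pt iterD. Qed.

Let iter_wrap n a b : n + a = b + N -> iter n g (pt a) = pt b.
Proof. by move=> Eb; rewrite iter_pt Eb pt_period. Qed.

Let iter_top n b : n = b.+1 -> iter n g top = pt b.
Proof. by move=> ->; apply: iter_wrap; lia. Qed.

Lemma third_swap_id v w : v != pt 0 -> v != pt 1 -> v != top ->
  third_swap (v, w) = (v, w).
Proof.
by rewrite /third_swap !xpair_eqE; do 3!move/negPf ->.
Qed.

Lemma third_swap0 u : third_swap (pt 0, u) =
  if u == top then (pt 1, top) else
  if u == pt (N - 2) then (top, pt 0) else (pt 0, u).
Proof.
rewrite /third_swap !xpair_eqE eqxx (small_neq (_ : 0 < 1 < N)); last by lia.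
by rewrite (small_neq (_ : 0 < N - 1 < N)) //; lia.
Qed.

Lemma third_swap1 u : third_swap (pt 1, u) =
  if u == top then (pt 0, top) else (pt 1, u).
Proof.
rewrite /third_swap !xpair_eqE eqxx (small_neqr (_ : 0 < 1 < N)); last by lia.
by rewrite (small_neq (_ : 1 < N - 1 < N)) //; lia.
Qed.

Lemma third_swap_top u : third_swap (top, u) =
  if u == top then (pt 0, pt (N - 2)) else
  if u == pt 0 then (top, top) else (top, u).
Proof.
rewrite /third_swap !xpair_eqE eqxx (small_neqr (_ : 1 < N - 1 < N)); last by lia.
by rewrite (small_neqr (_ : 0 < N - 1 < N)) //; lia.
Qed.

Lemma third_columns x j : j <= N - 3 ->
  E (pt 1, x) (pt j.+1, iter (j * (m - 1)) g x).
Proof.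
elim: j => [|j IHj] lej; first exact: connect0.
apply: Etrans (IHj _) _; first by lia.
have := E1 (pt j.+1) (iter (j * (m - 1)) g x).
rewrite small_neq; last by lia.
rewrite -pt_inc // /inc (_ : (j.+2 == N) = false); last by lia.
rewrite third_swap_id ?small_top ?small_neqr //; try lia.
by rewrite -iterD -mulSn.
Qed.

Lemma third_last_column u : E (top, u) (third_swap (pt 0, iter (m - 3) g u)).
Proof.
have := E1 top u; rewrite eqxx (_ : g top = pt 0) //.
by rewrite -pt_inc // /inc; ifs.
Qed.

Lemma third_column0 u :
  E (pt 0, u) (pt 1, if iter (m - 1) g u == top then pt (m - 2)
                     else iter (m - 1) g u).
Proof.
have step w : E (pt 0, w) (third_swap (pt 1, iter (m - 1) g w)).
  by have := E1 (pt 0) w; rewrite small_neq //; lia.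
apply: Etrans (step u) _; rewrite third_swap1.
case: ifP => _; last exact: connect0.
have := step top; rewrite (@iter_top (m - 1) (m - 2)); last by lia.
by rewrite third_swap1 small_top //; lia.
Qed.

(** The rewiring of the return map [x |-> x - 2] of column 1. *)
Definition third_kappa (z : V) : V :=
  if z == pt (2 * m - 5) then pt (m - 3) else
  if z == pt (2 * m - 4) then pt (2 * m - 5) else
  if z == pt (m - 2) then top else
  if z == pt (m - 3) then pt (2 * m - 4) else
  if z == top then pt (m - 2) else z.

Lemma third_antediagonal : E (top, pt 0) (pt 1, pt (2 * m - 4)).
Proof.
apply: Etrans (third_last_column (pt 0)) _; rewrite iter_pt addn0 third_swap0.
rewrite small_top ?small_neq; try lia.
have := third_column0 (pt (m - 3)); rewrite iter_pt.
by rewrite (_ : m - 1 + (m - 3) = 2 * m - 4) ?small_top //; lia.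
Qed.

Lemma third_return x :
  E (pt 1, x) (pt 1, third_kappa (iter (N - 2) g x)).
Proof.
have [u Eu] : exists u, u = iter ((N - 3) * (m - 1)) g x by eexists.
have [y Ey] : exists y, y = iter (m - 1) g u by eexists.
have [y' Ey'] : exists y', y' = iter (m - 3) g y by eexists.
have [z Ez] : exists z, z = iter (m - 1) g y' by eexists.
apply: Etrans (third_columns x (leqnn _)) _; rewrite -Eu.
have step : E (pt (N - 3).+1, u) (third_swap (top, y)).
  have := E1 (pt (N - 3).+1) u; rewrite small_top -?Ey; last by lia.
  suff -> : g (pt (N - 3).+1) = top by [].
  rewrite -pt_inc // /top; congr (orbit_pt _ _ _); rewrite /inc; ifs; lia.
apply: Etrans step _.
have -> : iter (N - 2) g x = z.
  rewrite Ez Ey' Ey Eu -!iterD -[in LHS](iter_period orbg (m - 2) x) -iterD.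
  have cols n : 3 <= n ->
      n - 2 + (m - 2) * n = m - 1 + (m - 3 + (m - 1 + (n - 3) * (m - 1))).
    by move=> le3n; nia.
  by rewrite cols ?addnA //; lia.
have z_y : z = iter (2 * m - 4) g y.
  by rewrite Ez Ey' -iterD; congr (iter _ g y); lia.
have z5 : (z == pt (2 * m - 5)) = (y == top).
  rewrite z_y -(@iter_top (2 * m - 4)); last by lia.
  exact: inj_eq (@iter_inj _) _ _.
have z4 : (z == pt (2 * m - 4)) = (y == pt 0).
  by rewrite z_y -(inj_eq (@iter_inj (2 * m - 4)) y) iter_pt addn0.
have z2 : (z == pt (m - 2)) = (y' == top).
  rewrite Ez -(@iter_top (m - 1)); last by lia.
  exact: inj_eq (@iter_inj _) _ _.
have z3 : (z == pt (m - 3)) = (y' == pt (N - 2)).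
  rewrite Ez -(@iter_wrap (m - 1) (N - 2)); last by clear z5 z4 z2; lia.
  exact: inj_eq (@iter_inj _) _ _.
rewrite third_swap_top /third_kappa z5 z4 z2 z3 {z5 z4 z2 z3}.
case: ifP => _.
  have := third_column0 (pt (N - 2)); rewrite (@iter_wrap (m - 1) (N - 2) (m - 3)); last by lia.
  by rewrite small_top //; lia.
case: ifP => _.
  apply: Etrans (third_last_column top) _; rewrite (@iter_top (m - 3) (m - 4)); last by lia.
  rewrite third_swap0 small_top ?small_neq; try lia.
  have := third_column0 (pt (m - 4)); rewrite iter_pt.
  by rewrite (_ : m - 1 + (m - 4) = 2 * m - 5) ?small_top //; lia.
apply: Etrans (third_last_column y) _; rewrite third_swap0 -Ey'.
case: ifP => _; first exact: connect0.
case: ifP => _; first exact: third_antediagonal.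
by rewrite Ez; apply: third_column0.
Qed.

Let R x y := E (pt 1, x) (pt 1, y).
Let Rtrans x y z : R x y -> R y z -> R x z. Proof. exact: connect_trans. Qed.
Let Rsym x y : R x y -> R y x.
Proof. by rewrite /R /E (fconnect_sym third_walk_inj). Qed.

Lemma third_kappa_id z : z != pt (2 * m - 5) -> z != pt (2 * m - 4) ->
  z != pt (m - 2) -> z != pt (m - 3) -> z != top -> third_kappa z = z.
Proof. by rewrite /third_kappa; do 5!move/negPf ->. Qed.

Lemma third_run a b : b < a -> odd a = odd b ->
  (forall c, b < c < a -> odd c = odd a -> third_kappa (pt c) = pt c) ->
  R (pt a) (third_kappa (pt b)).
Proof.
move=> lt_ba par fixed.
have down i : 2 * i <= a -> iter i (iter (N - 2) g) (pt a) = pt (a - 2 * i).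
  elim: i => [|i IHi] lei; first by rewrite muln0 subn0.
  rewrite iterS IHi ?iter_pt; last by lia.
  rewrite (_ : N - 2 + (a - 2 * i) = a - 2 * i.+1 + N); last by lia.
  by rewrite pt_period.
have -> : pt b = iter ((a - b)./2) (iter (N - 2) g) (pt a).
  by rewrite down; [congr (orbit_pt _ _ _)|]; lia.
apply: (@rewired_run V (iter (N - 2) g) third_kappa R) => [x|x y z|x||i lei].
- exact: connect0.
- exact: Rtrans.
- exact: third_return.
- by lia.
by rewrite down; [apply: fixed|]; lia.
Qed.

Let kappa_id c : c < N -> c != 2 * m - 5 -> c != 2 * m - 4 -> c != m - 2 ->
  c != m - 3 -> c != N - 1 -> third_kappa (pt c) = pt c.
Proof. by move=> *; apply: third_kappa_id; rewrite eq_pt //; lia. Qed.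

(** Runs by [-2] from one rewired point down to the next one of the same parity;
    the rewiring makes the end of each run the beginning of another. *)
Lemma third_hubs z :
  z \in [:: pt (2 * m - 5); pt (2 * m - 4); pt (m - 2); pt (m - 3); top] ->
  R z top.
Proof.
have k5 : third_kappa (pt (2 * m - 5)) = pt (m - 3) by rewrite /third_kappa eqxx.
have k2 : third_kappa (pt (m - 2)) = top.
  by rewrite /third_kappa eqxx !ifN // eq_pt; lia.
have k3 : third_kappa (pt (m - 3)) = pt (2 * m - 4).
  by rewrite /third_kappa eqxx !ifN // eq_pt; lia.
have k_top : third_kappa top = pt (m - 2).
  by rewrite /third_kappa eqxx !ifN // eq_pt; lia.
have r3 : R (pt (m - 3)) top.
  apply: Rsym; rewrite -k5; apply: third_run; try lia.
  by move=> c ltc par; apply: kappa_id; lia.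
have r4 : R (pt (2 * m - 4)) top.
  rewrite -k2; apply: third_run; try lia.
  by move=> c ltc par; apply: kappa_id; lia.
have r5 : R (pt (2 * m - 5)) (pt (2 * m - 4)).
  rewrite -k3; apply: third_run; try lia.
  by move=> c ltc par; apply: kappa_id; lia.
have r2 : R (pt (m - 3)) (pt (m - 2)).
  rewrite -k_top -(pt_period x0 orbg); apply: third_run; try lia.
  move=> c ltc par; have Ec : c = c - N + N by lia.
  by rewrite Ec pt_period //; apply: kappa_id; lia.
rewrite !inE => /orP[|/or4P[]] /eqP -> //; last exact: connect0.
- exact: Rtrans r5 r4.
exact: Rtrans (Rsym r2) r3.
Qed.

Lemma third_column1 x : R x top.
Proof.
pose P z := z \in [:: pt (2 * m - 5); pt (2 * m - 4); pt (m - 2); pt (m - 3); top].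
have N2 : N - 2 = 2 * (N./2 - 1) by lia.
have cop : coprime (N./2 - 1) N.
  rewrite {2}(_ : N = 2 * (N./2 - 1) + 2); last by lia.
  by rewrite /coprime gcdnMDl -/(coprime _ _) coprimen2; lia.
have [e Pe xe] : exists2 e, P e & fconnect (iter (N - 2) g) (iter (N - 2) g x) e.
  exists (if odd (pos (iter (N - 2) g x)) then top else pt (m - 2)).
    by rewrite /P; case: ifP; rewrite !inE eqxx ?orbT.
  rewrite -{1}(posK x0 orbg (iter (N - 2) g x)) {1}N2 (parity_class x0 orbg N_even cop).
  by case: ifP => par; rewrite ptK //; lia.
have [||||e' Pe' xe'] := @rewired_exit V (iter (N - 2) g) third_kappa R _ _ _ P x e Pe xe.
- by move=> y; apply: connect0.
- exact: Rtrans.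
- exact: third_return.
- move=> z; rewrite /P !inE !negb_or => /and5P[]; exact: third_kappa_id.
apply: Rtrans xe' _; apply: third_hubs; move: Pe'; rewrite /P !inE.
by case/orP => [|/or4P[]] /eqP ->; rewrite /third_kappa; do !case: ifP => _;
  rewrite eqxx ?orbT.
Qed.

Lemma third_walk_orbit : single_orbit third_walk.
Proof.
apply: (single_orbitI (x0 := (pt 1, top)) third_walk_inj) => -[v w].
suff [x vx] : exists x, E (v, w) (pt 1, x) by apply: Etrans vx (third_column1 x).
rewrite -(posK x0 orbg v); have := pos_lt x0 orbg v; move: (pos v) => j ltj.
have [->|neq0] := eqVneq j 0; first by eexists; apply: third_column0.
have [->|neq_j] := eqVneq j (N - 1).
  have := third_last_column w; rewrite third_swap0.
  case: ifP => _; first by exists top.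
  case: ifP => _ vx; eexists; apply: Etrans vx _; first exact: third_antediagonal.
  exact: third_column0.
have [gV _ gVK] := injF_bij (@iter_inj (j.-1 * (m - 1))).
exists (gV w); rewrite /E (fconnect_sym third_walk_inj).
have := third_columns (gV w) (_ : j.-1 <= N - 3); rewrite gVK prednK; last by lia.
by apply; lia.
Qed.

Lemma even_third_orbit : single_orbit (third m).
Proof.
apply: eq_single_orbit (fun y => esym (third_split y)) _.
exact: single_orbit_conj third_tail_inj third_walk_orbit.
Qed.

End EvenThird.

Lemma even_length_decomposable (m : nat) (V : finType) (k : nat)
    (f : 'I_k.+1 -> V -> V) (x0 : V) (h : V -> 'Z_m) :
  4 <= m -> ~~ odd m -> 0 < k -> #|V| = m ^ k.+1 ->
  (forall i, single_orbit (f i)) -> graded f h ->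
  ham_decomposable (@odd_step m V _ f).
Proof.
move=> m_ge4 m_even k_gt0 cardV f_orb f_graded.
have m_ge3 : 3 <= m by lia.
have N_even : ~~ odd #|V| by rewrite cardV oddX.
have N_four : 4 %| #|V|.
  case: k k_gt0 f cardV {f_orb f_graded} => // k _ _ ->; rewrite !expnS mulnA dvdn_mulr //.
  by apply: (@dvdn_mul 2 2); rewrite dvdn2.
have N_ge : 4 * m <= #|V| by exact: four_mul_le_card k_gt0 cardV m_ge4.
have s_le : num_special m k <= #|V| - 2 by exact: num_special_lt k_gt0 cardV m_ge4.
have s_eq : num_special m k = 2 * (m * k + 1) by rewrite /num_special; lia.
have cop_q : coprime (m * k + 1) #|V|.
  by apply: (coprime_N cardV); rewrite coprime_sym /coprime mulnC gcdnMDl gcdn1.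
apply: (@odd_decomposable m V k f h (even_tri m f x0) (special_row m f x0)) => //.
- by apply: (coprime_N cardV); rewrite coprimePn //; lia.
- exact: even_tri_perm.
- by move=> t w; apply: special_layer.
- exact: even_tri_special.
- by move=> i t; apply: coprime_special.
- by move=> t w i; apply: special_neq0.
- exact: (even_first_orbit x0 m_ge4 m_even k_gt0 cardV f_orb).
- exact: even_second_orbit N_even N_ge s_le s_eq cop_q.
exact: even_third_orbit.
Qed.

(** * The induction on the dimension *)

Section Induction.

Import GRing.Theory.

Variable m : nat.
Hypothesis m_ge3 : 3 <= m.

Let Zp_val_bound : (Zp_trunc m).+2 = m.
Proof. by apply: Zp_cast; lia. Qed.

Lemma card_torus k : #|{: 'rV['Z_m]_k}| = m ^ k.
Proof. by rewrite card_mx card_ord mul1n Zp_val_bound. Qed.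

Lemma ham_decomposable_cycle : ham_decomposable (@torus_step m 1).
Proof.
exists (fun _ c => c); split=> [x|c]; first exact: inj_id.
apply: single_orbit_iter => x y.
exists (y ord0 ord0 - x ord0 ord0)%R.
have iterE n z : iter n (torus_step c) z = (z + delta_mx ord0 c *+ n)%R.
  by elim: n => [|n IHn]; rewrite ?mulr0n ?addr0 //= IHn mulrSr addrA.
rewrite iterE; apply/matrixP => i j.
rewrite !ord1 mxE mulmxnE mxE !eqxx natr_Zp /=.
by rewrite addrC subrK.
Qed.

Lemma ham_decomposable_double k :
  ham_decomposable (@torus_step m k) -> ham_decomposable (@torus_step m (k + k)).
Proof.
move/(ham_decomposable_square (0 : 'rV['Z_m]_k)%R).
pose phi (x : 'rV['Z_m]_k * 'rV['Z_m]_k) : 'rV['Z_m]_(k + k) := row_mx x.1 x.2.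
pose psi (x : 'rV['Z_m]_(k + k)) := (lsubmx x, rsubmx x).
apply: (@ham_decomposable_transport _ _ _ _ _ _ phi psi (@unsplit k k) (@split k k)).
- by move=> x; rewrite /phi hsubmxK.
- by move=> [v w]; rewrite /phi /psi row_mxKl row_mxKr.
- exact: unsplitK.
- exact: splitK.
move=> [i|i] [v w]; rewrite /phi /torus_step /=.
  by rewrite delta_mx_lshift add_row_mx addr0.
by rewrite delta_mx_rshift add_row_mx addr0.
Qed.

Lemma ham_decomposable_double_succ k : 0 < k ->
  ham_decomposable (@torus_step m k) ->
  ham_decomposable (@torus_step m (1 + (k + k))).
Proof.
case: k => // k _ [rule [rule_inj rule_orb]].
apply: ham_decomposable_odd_torus; apply: (odd_step_refine rule_inj).
set f := fun i v => _.
have f_graded : graded f (@coord_sum m k.+1) by move=> i v; apply: coord_sum_graded.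
have cardV := card_torus k.+1.
have x0 : 'rV['Z_m]_k.+1 := 0%R.
have f_orb i : single_orbit (f i) by apply: rule_orb.
move: f f_graded f_orb => {rule rule_inj rule_orb}.
case: k cardV x0 => [|k] cardV x0 f f_graded f_orb; first rewrite expn1 in cardV.
  have [m_odd|m_even] := boolP (odd m).
    exact: (three_odd_decomposable x0 m_ge3 m_odd cardV f_orb f_graded).
  have [m4|m_neq4] := eqVneq m 4; last first.
    by apply: (three_even_decomposable _ m_even cardV f_orb f_graded); lia.
  subst m; exact: (three_four_decomposable cardV f_orb f_graded).
have [m_odd|m_even] := boolP (odd m).
  exact: (odd_length_decomposable x0 m_ge3 m_odd _ cardV f_orb f_graded).
by apply: (even_length_decomposable x0 _ m_even _ cardV f_orb f_graded); lia.
Qed.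

Lemma ham_decomposable_torus d : 0 < d -> ham_decomposable (@torus_step m d).
Proof.
have [n] := ubnP d; elim: n d => // n IHn d le_dn d_gt0.
have [->|d_neq1] := eqVneq d 1; first exact: ham_decomposable_cycle.
have half : ham_decomposable (@torus_step m d./2) by apply: IHn; lia.
rewrite -(odd_double_half d) -addnn; case: (odd d).
  by apply: ham_decomposable_double_succ half; lia.
exact: ham_decomposable_double half.
Qed.

End Induction.

Theorem theorem1p1 (m d : nat) (hm : (3 <= m)%N) (hd : (2 <= d)%N) :
  exists P : {set {set 'rV['Z_m]_d * 'rV['Z_m]_d}},
    hamilton_decomposition (torus_arcs m d) d P.
Proof.
apply: hamilton_decomposition_torus; apply: ham_decomposable_torus => //.
exact: ltnW.
Qed.
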